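(* Let $\widehat M:=1+z+\sum_{n\ge 3}[\overline{\mathcal M}_{0,n}]\frac{z^{n-1}}{(n-1)!}$ and let $T=T(e^z\mathbb L)$, where $T(t)$ is the tree function. Then $$\widehat M=\frac{T}{\mathbb L}\sum_{m\ge 0}\frac{(-1)^mF_m(z,T)}{(1-T)^{2m-1}}\,\mathbb L^m$$ as formal power series in $z$ and $\mathbb L$, where $F_0(z,\tau)=\frac1{1-\tau}$ and, for $m>0$, $F_m(z,\tau)\in\mathbb Q[z,\tau]$ are the polynomials defined in the context.
   Context: $\overline{\mathcal M}_{0,n}$ ($n\ge 3$) is the moduli space of stable $n$-pointed curves of genus $0$, and $[\overline{\mathcal M}_{0,n}]$ is its class in the Grothendieck ring of varieties. With $\mathbb L=[\mathbb A^1]$, this class is the polynomial $[\overline{\mathcal M}_{0,n}]=\sum_{k=0}^{n-3}\operatorname{rk}H^{2k}(\overline{\mathcal M}_{0,n})\,\mathbb L^k$; $\mathbb L$ is treated as an indeterminate. The tree function is $T(t)=-W(-t)=\sum_{n\ge1}\frac{n^{n-1}t^n}{n!}$, with $W$ the principal branch of the Lambert W-function ($W(t)e^{W(t)}=t$). For $k\ge0$ put $\alpha_k(z)=\sum_{n\ge 3}\operatorname{rk}H^{2k}(\overline{\mathcal M}_{0,n})\frac{z^{n-1}}{(n-1)!}$. It is known (earlier work) that there are unique polynomials $p^{(k)}_m(z)\in\mathbb Q[z]$, $0\le m\le k$, with $$e^z\sum_{m=0}^k(-1)^m p^{(k)}_m(z)\,e^{(k-m)z}=\begin{cases}\alpha_k(z)&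 k\ge 1\\ 1+z+\alpha_0(z)& k=0.\end{cases}$$ For $m>0$, $F_m(z,\tau)\in\mathbb Q[z,\tau]$ is the unique polynomial (it exists, has degree $2m$ in $z$ and degree $<3m$ in $\tau$) such that $$\sum_{\ell\ge 0}p^{(m+\ell)}_m(z)\,t^\ell=e^{T(t)}\frac{F_m(z,T(t))}{(1-T(t))^{2m-1}};$$ equivalently, $F_m$ is the polynomial of degree $<3m$ in $\tau$ with $F_m(z,\tau)\equiv\sum_{\ell=0}^{3m-1}p^{(m+\ell)}_m(z)(1-\tau)^{2m-1}e^{-(\ell+1)\tau}\tau^\ell \bmod \tau^{3m}$. *)

(* Defs.v *)
From HB Require Import structures.
From mathcomp Require Import all_boot all_order all_algebra.
From mathcomp Require Import boolp.
From mathcomp Require Import freeg mpoly.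

Set Implicit Arguments.
Unset Strict Implicit.
Unset Printing Implicit Defensive.

Import GRing.Theory.
Local Open Scope ring_scope.

(* Formal power series over [R]; [f n] is the coefficient of degree [n].      *)
Record fps (R : Type) := Fps { fcoef :> nat -> R }.

Notation "{ 'fps' R }" := (fps R) (at level 0, R at level 2, format "{ 'fps'  R }").
Notation "\fps_ ( n ) E" := (Fps (fun n : nat => E))
  (at level 36, E at level 36, n name, format "\fps_ ( n )  E").

Lemma fpsP R (f g : {fps R}) : f =1 g -> f = g.
Proof. by case: f => f; case: g => g /= /funext ->. Qed.

HB.instance Definition _ (R : Type) := gen_eqMixin {fps R}.
HB.instance Definition _ (R : Type) := gen_choiceMixin {fps R}.

Section FpsZmod.
Variable R : zmodType.
Implicit Types f g h : {fps R}.

Definition fps_zero : {fps R} := \fps_(n) 0.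
Definition fps_opp f : {fps R} := \fps_(n) (- f n).
Definition fps_add f g : {fps R} := \fps_(n) (f n + g n).

Fact fps_addA : associative fps_add.
Proof. by move=> f g h; apply: fpsP => n /=; rewrite addrA. Qed.
Fact fps_addC : commutative fps_add.
Proof. by move=> f g; apply: fpsP => n /=; rewrite addrC. Qed.
Fact fps_add0 : left_id fps_zero fps_add.
Proof. by move=> f; apply: fpsP => n /=; rewrite add0r. Qed.
Fact fps_addN : left_inverse fps_zero fps_opp fps_add.
Proof. by move=> f; apply: fpsP => n /=; rewrite addNr. Qed.

HB.instance Definition _ :=
  GRing.isZmodule.Build {fps R} fps_addA fps_addC fps_add0 fps_addN.

End FpsZmod.

Lemma fps0E (R : zmodType) n : (0 : {fps R}) n = 0. Proof. by []. Qed.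
Lemma fpsDE (R : zmodType) (f g : {fps R}) n : (f + g) n = f n + g n.
Proof. by []. Qed.
Lemma fpsNE (R : zmodType) (f : {fps R}) n : (- f) n = - f n.
Proof. by []. Qed.

Lemma fps_sumE (R : zmodType) I (r : seq I) (P : pred I) (F : I -> {fps R}) n :
  (\sum_(i <- r | P i) F i) n = \sum_(i <- r | P i) F i n.
Proof. by elim/big_rec2: _ => // i x y _ <-. Qed.

Section FpsRing.
Variable R : comNzRingType.
Implicit Types f g h : {fps R}.

Definition fps_const (c : R) : {fps R} := \fps_(n) (if n is 0 then c else 0).
Definition fps_mul f g : {fps R} := \fps_(n) \sum_(i < n.+1) f i * g (n - i)%N.

Let tr N f : {poly R} := \poly_(i < N) f i.

Let fps_mulE f g n N : (n < N)%N -> fps_mul f g n = (tr N f * tr N g)`_n.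
Proof.
move=> nN; rewrite coefM; apply: eq_bigr => i _; rewrite !coef_poly.
have iN : (i < N)%N by apply: leq_trans nN; rewrite ltnS -ltnS.
by rewrite iN (leq_ltn_trans (leq_subr i n) nN).
Qed.

Fact fps_mulA : associative fps_mul.
Proof.
move=> f g h; apply: fpsP => n.
transitivity (tr n.+1 f * (tr n.+1 g * tr n.+1 h))`_n.
  rewrite coefM; apply: eq_bigr => i _; rewrite coef_poly ltn_ord; congr (_ * _).
  by rewrite -fps_mulE // ltnS leq_subr.
rewrite mulrA coefM; apply: eq_bigr => i _; rewrite coef_poly ltnS leq_subr.
by rewrite -fps_mulE.
Qed.

Fact fps_mulC : commutative fps_mul.
Proof.
by move=> f g; apply: fpsP => n; rewrite !(fps_mulE _ _ (ltnSn n)) mulrC.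
Qed.

Fact fps_mul1 : left_id (fps_const 1) fps_mul.
Proof.
move=> f; apply: fpsP => n /=; rewrite big_ord_recl subn0 mul1r big1 ?addr0 //.
by move=> i _; rewrite mul0r.
Qed.

Fact fps_mulDl : left_distributive fps_mul +%R.
Proof.
move=> f g h; apply: fpsP => n; rewrite fpsDE /= -big_split /=.
by apply: eq_bigr => i _; rewrite mulrDl.
Qed.

Fact fps_1neq0 : fps_const 1 != 0.
Proof. by apply/eqP => /(congr1 (fun f => f 0%N))/eqP; rewrite oner_eq0. Qed.

HB.instance Definition _ := GRing.Zmodule_isComNzRing.Build {fps R}
  fps_mulA fps_mulC fps_mul1 fps_mulDl fps_1neq0.

Lemma fpsME f g n : (f * g) n = \sum_(i < n.+1) f i * g (n - i)%N.
Proof. by []. Qed.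

Lemma fps1E n : (1 : {fps R}) n = (n == 0)%:R.
Proof. by case: n. Qed.

Lemma fps_exp_small f n m : f 0 = 0 -> (m < n)%N -> (f ^+ n) m = 0.
Proof.
move=> f0; elim: n m => // n IHn m mn.
rewrite exprS fpsME big1 // => -[[|i] /= im] _; first by rewrite f0 mul0r.
by rewrite IHn ?mulr0 //; case: m mn im => //= m; rewrite !ltnS => mn _;
   rewrite subSS; apply: leq_ltn_trans mn; rewrite leq_subr.
Qed.

Definition fps_var : {fps R} := \fps_(n) (n == 1)%:R.

(* [f / X], for [f] without constant term.                                    *)
Definition fps_divX f : {fps R} := \fps_(n) f n.+1.

(* The infinite sum [\sum_(m >= 0) F m], for families such that [F m] has     *)
(* order at least [m].                                                        *)
Definition fps_series (F : nat -> {fps R}) : {fps R} :=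
  \fps_(n) \sum_(m < n.+1) F m n.

(* [f(g)], for [g] without constant term.                                     *)
Definition fps_comp f g : {fps R} :=
  fps_series (fun m => fps_const (f m) * g ^+ m).

End FpsRing.

Arguments fps_var {R}.

Section FpsUnit.
Variable R : comUnitRingType.
Implicit Types f g h : {fps R}.

Definition fps_unit : pred {fps R} := fun f => f 0 \is a GRing.unit.

(* [f = c (1 - h)] with [c = f 0], hence [f^-1 = c^-1 \sum_i h ^+ i].         *)
Definition fps_inv f : {fps R} :=
  if fps_unit f then
    fps_const (f 0)^-1
      * fps_series (fun m => (1 - fps_const (f 0)^-1 * f) ^+ m)
  else f.

Fact fps_mulVf : {in fps_unit, left_inverse 1 fps_inv *%R}.
Proof.
move=> f uf; rewrite /fps_inv (uf : fps_unit f).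
set c := fps_const _; set h := 1 - c * f.
have h0 : h 0 = 0.
  rewrite fpsDE fpsNE fps1E fpsME big_ord1 /= mulVr ?subrr //.
rewrite mulrAC -[c * f](subKr 1) -/h.
have SE n j : (j < n)%N ->
    fps_series (fun m => h ^+ m) j = (\sum_(m < n) h ^+ m) j.
  move=> jn; rewrite fps_sumE /= (big_ord_widen n (fun m => (h ^+ m) j)) //.
  rewrite [in RHS](bigID (fun m : 'I_n => (m < j.+1)%N)) /= [X in _ + X]big1.
    by rewrite addr0.
  by move=> m; rewrite -leqNgt => jm; rewrite fps_exp_small.
apply: fpsP => n; rewrite fpsME.
transitivity (((1 - h) * \sum_(m < n.+1) h ^+ m) n).
  by rewrite fpsME; apply: eq_bigr => i _; rewrite (SE n.+1) // ltnS leq_subr.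
rewrite -[1 - h]opprB mulNr -subrX1 opprB fpsDE fpsNE.
by rewrite (fps_exp_small h0 (ltnSn n)) subr0.
Qed.

Fact fps_unitPl f g : g * f = 1 -> fps_unit f.
Proof.
move/(congr1 (fun h : {fps R} => h 0%N)); rewrite fpsME big_ord1 fps1E => fg1.
by apply/unitrPr; exists (g 0%N); rewrite mulrC.
Qed.

Fact fps_invr_out : {in [predC fps_unit], fps_inv =1 id}.
Proof.
by move=> f nuf; rewrite /fps_inv ifN.
Qed.

HB.instance Definition _ := GRing.ComNzRing_hasMulInverse.Build {fps R}
  fps_mulVf fps_unitPl fps_invr_out.

Lemma fps_unitE f : (f \is a GRing.unit) = (f 0%N \is a GRing.unit).
Proof. by []. Qed.

End FpsUnit.

(* Affine schemes of finite type over [k]: [existT _ n I] stands for          *)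
(* [Spec k[x_0, .., x_(n-1)] / (I)], a closed subscheme of affine [n]-space.  *)
Definition affine (k : fieldType) : Type := {n : nat & seq {mpoly k[n]}}.
HB.instance Definition _ (k : fieldType) := Choice.on (affine k).

Definition Affine (k : fieldType) n (I : seq {mpoly k[n]}) : affine k :=
  existT (fun n => seq {mpoly k[n]}) n I.

Definition affine_space (k : fieldType) (n : nat) : affine k :=
  Affine ([::] : seq {mpoly k[n]}).

Definition in_ideal (A : comNzRingType) (I : seq A) (f : A) : Prop :=
  exists c : 'I_(size I) -> A, f = \sum_i c i * I`_i.

(* [phi] and [psi] represent mutually inverse isomorphisms between the        *)
(* coordinate rings.                                                          *)
Definition affine_iso (k : fieldType) (X Y : affine k) : Prop :=
  exists (phi : (tag Y).-tuple {mpoly k[tag X]})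
         (psi : (tag X).-tuple {mpoly k[tag Y]}),
  [/\ forall f, f \in tagged Y -> in_ideal (tagged X) (f \mPo phi),
      forall f, f \in tagged X -> in_ideal (tagged Y) (f \mPo psi),
      forall i, in_ideal (tagged X) ((tnth psi i \mPo phi) - 'X_i)
    & forall j, in_ideal (tagged Y) ((tnth phi j \mPo psi) - 'X_j)].

(* The closed subscheme [f = 0] of [V(I)] and its open complement [f <> 0],   *)
(* the latter embedded in affine [n+1]-space by [1 - f * x_n = 0].            *)
Definition closed_part (k : fieldType) n (I : seq {mpoly k[n]}) (f : {mpoly k[n]}) :
  affine k := Affine (f :: I).
Definition open_part (k : fieldType) n (I : seq {mpoly k[n]}) (f : {mpoly k[n]}) :
  affine k := Affine ((1 - mwiden f * 'X_ord_max) :: [seq mwiden g | g <- I]).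

(* The Grothendieck group of varieties over [k] is the free abelian group on  *)
(* affine schemes of finite type modulo isomorphism and the scissor relations *)
(* [X] = [X /\ (f = 0)] + [X /\ (f <> 0)]. Restricting to affine generators   *)
(* and to principal cuts loses nothing, since every variety is a finite       *)
(* disjoint union of locally closed affine ones; cutting along a nilpotent    *)
(* [f] identifies a scheme with its reduction.                                *)
Inductive K0_null (k : fieldType) : {freeg (affine k) / int} -> Prop :=
| K0_null0 : K0_null 0
| K0_nullB a b : K0_null a -> K0_null b -> K0_null (a - b)
| K0_null_iso X Y : affine_iso X Y -> K0_null (<< X >> - << Y >>)
| K0_null_cut n (I : seq {mpoly k[n]}) f :
    K0_null (<< Affine I >> - << closed_part I f >> - << open_part I f >>).

Definition K0_eq (k : fieldType) (a b : {freeg (affine k) / int}) : Prop :=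
  K0_null (a - b).

(* [P(L)] for [L = [A^1]], using [L^j = [A^j]].                               *)
Definition K0_horner (k : fieldType) (P : {poly int}) : {freeg (affine k) / int} :=
  \sum_(j < size P) << P`_j *g affine_space k j >>.

(* The moduli space of stable [n]-pointed curves of genus 0, in the form of   *)
(* Gerritzen, Herrlich and van der Put (Stable n-pointed trees of projective  *)
(* lines, 1988): sending a stable curve to the cross-ratios                   *)
(*   l(a,b,c,d) = ((a - c)(b - d) : (a - d)(b - c))                           *)
(* of its quadruples of distinct marked points (i.e. to its images under the  *)
(* forgetful maps to [M_(0,4) = P^1]) is an isomorphism onto the closed       *)
(* subscheme of [\prod_(quadruples) P^1] with equations                       *)
(*   l(b,a,c,d) = l(a,b,c,d)^-1,       l(a,b,d,c) = l(a,b,c,d)^-1,            *)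
(*   l(a,c,b,d) = 1 - l(a,b,c,d),      l(a,b,c,d) l(a,b,d,e) = l(a,b,c,e).    *)
(* Below, [x q] and [y q] are homogeneous coordinates [(x q : y q)] of the    *)
(* factor of index [q], and the four families are made multihomogeneous.      *)
Definition quad (n : nat) := {q : 4.-tuple 'I_n | uniq q}.

Definition crossratio_eqs (n : nat) (A : comNzRingType) (x y : 4.-tuple 'I_n -> A) :
    seq A :=
  [seq let: (a, b, c, d) := (tnth t 0, tnth t 1, tnth t 2, tnth t 3) in
       x [tuple a; b; c; d] * x [tuple b; a; c; d]
         - y [tuple a; b; c; d] * y [tuple b; a; c; d]
     | t : 4.-tuple 'I_n <- enum {: 4.-tuple 'I_n} & uniq t] ++
  [seq let: (a, b, c, d) := (tnth t 0, tnth t 1, tnth t 2, tnth t 3) in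
       x [tuple a; b; c; d] * x [tuple a; b; d; c]
         - y [tuple a; b; c; d] * y [tuple a; b; d; c]
     | t : 4.-tuple 'I_n <- enum {: 4.-tuple 'I_n} & uniq t] ++
  [seq let: (a, b, c, d) := (tnth t 0, tnth t 1, tnth t 2, tnth t 3) in
       x [tuple a; c; b; d] * y [tuple a; b; c; d]
         - y [tuple a; c; b; d] * (y [tuple a; b; c; d] - x [tuple a; b; c; d])
     | t : 4.-tuple 'I_n <- enum {: 4.-tuple 'I_n} & uniq t] ++
  [seq let: (a, b, c, d, e) :=
         (tnth t 0, tnth t 1, tnth t 2, tnth t 3, tnth t 4) in
       x [tuple a; b; c; d] * x [tuple a; b; d; e] * y [tuple a; b; c; e]
         - y [tuple a; b; c; d] * y [tuple a; b; d; e] * x [tuple a; b; c; e]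
     | t : 5.-tuple 'I_n <- enum {: 5.-tuple 'I_n} & uniq t].

(* [\prod_q P^1] is the disjoint union, over the sets [S] of quadruples, of   *)
(* the affine cells [{(1 : 0)}^S * \prod_(q \notin S) {(u : 1)}]; [Mbar_cell] *)
(* is the part of the moduli space in such a cell, embedded in [A^quad n] by  *)
(* setting the unused coordinates to 0. The values of the homogeneous         *)
(* coordinates at tuples with repetitions are not used.                       *)
Section Mbar.
Variables (k : fieldType) (n : nat) (S : {set quad n}).
Let N := #|{: quad n}|.
Definition cell_var (q : quad n) : {mpoly k[N]} := 'X_(enum_rank q).
Definition cell_x (t : 4.-tuple 'I_n) : {mpoly k[N]} :=
  if (insub t : option (quad n)) is Some q then
    if q \in S then 1 else cell_var q
  else 0.
Definition cell_y (t : 4.-tuple 'I_n) : {mpoly k[N]} :=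
  if (insub t : option (quad n)) is Some q then
    if q \in S then 0 else 1
  else 0.
Definition Mbar_cell : affine k :=
  Affine (crossratio_eqs cell_x cell_y ++ [seq cell_var q | q in S]).
End Mbar.

Definition Mbar_class (k : fieldType) (n : nat) : {freeg (affine k) / int} :=
  \sum_(S : {set quad n}) << Mbar_cell k S >>.

(* [P] is the class of the moduli space as a polynomial in [L], over any base *)
(* field; its coefficients are the ranks of the even cohomology groups.       *)
Definition is_Mbar_class_poly (n : nat) (P : {poly int}) : Prop :=
  forall k : fieldType, K0_eq (Mbar_class k n) (K0_horner k P).

(* [Q[[z]]], and [Q[[z]][[t]]] or [Q[[z]][[L]]], identified with power series *)
(* in two variables.                                                          *)
Notation Qz := {fps rat}.
Notation Qzt := {fps {fps rat}}.

Definition exp_fps (a : rat) : Qz := \fps_(n) (a ^+ n / n`!%:R).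

Definition tree_fps : Qz := \fps_(n) (if n is 0 then 0 else (n ^ n.-1)%:R / n`!%:R).

Definition poly_fps (p : {poly rat}) : Qz := \fps_(n) p`_n.

(* A power series with rational coefficients, in the outer variable.          *)
Definition outer_fps (f : Qz) : Qzt := \fps_(n) fps_const (f n).

(* [F(z, u)] for [F] in [Q[z][tau]].                                          *)
Definition eval_ztau (F : {poly {poly rat}}) (u : Qzt) : Qzt :=
  (map_poly (fun p => fps_const (poly_fps p)) F).[u].

(* Throughout, [M n] is the class of the moduli space of stable [n]-pointed   *)
(* curves as a polynomial in [L], so that [(M n)`_k] is [rk H^(2k)].          *)
Definition alpha (M : nat -> {poly int}) (k : nat) : Qz :=
  \fps_(i) (if (3 <= i.+1)%N then ((M i.+1)`_k)%:~R / i`!%:R else 0).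

Definition Mhat (M : nat -> {poly int}) : Qzt :=
  fps_const (1 + fps_var)
  + \fps_(k) \fps_(i) (if (3 <= i.+1)%N then ((M i.+1)`_k)%:~R / i`!%:R else 0).

(* Main.v *)
(* The expansion in question regroups the terms of [Mhat] by m: its coefficient of L^k is
   [e^z \sum_m (-1)^m p^(k)_m e^((k-m)z)], so that the terms of index m add up to
   [(-1)^m L^m e^z P_m(e^z L)] with [P_m(t) = \sum_l p^(m+l)_m t^l]. For [m > 0] the definition of
   [F_m] and [e^T(t) = T(t)/t] (Abel's identity) give the stated term. For [m = 0] one has to show
   [P_0 = e^T], i.e. [p^(k)_0 = (k+1)^(k-1)/k!], which needs the geometry.

   The number of F_q-points is additive on the Grothendieck group, so [M n] evaluated at q is the
   number of solutions of the cross-ratio equations over F_q. With the label r as root, the system of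
   functions f on the other labels satisfying [l(r,b,c,d) (f b - f c) = f b - f d] (for all b, c, d)
   is two-dimensional, and for a given f the solutions compatible with f correspond to families of
   solutions on the fibres of f together with r. Counting pairs (solution, f) in two ways gives,
   with g_n the number of solutions on n + 1 labels,
     [q^2 g_n = \sum_(f : n -> F_q) \prod_y g_(#f^-1(y))] for n >= 2,
   that is, [E^q = 1 + q z + q^2 (E - 1 - z)] for the exponential generating series E of g. Hence
   [E' (1 + q + q z - q E) = E] for all primes q, and so [Mhat' (1 + L + L z - L Mhat) = Mhat].
   Since exponential polynomials in z are linearly independent, the coefficient of L^k e^((k+1)z) can
   be extracted; it shows that [c_k = p^(k)_0] is constant and that [C = \sum_k c_k t^k] satisfies
   [C' = (t C)' C], the equation characterising e^T. *)
From HB Require Import structures.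
Require Import Defs.
From mathcomp Require Import all_boot all_order all_algebra.
From mathcomp Require Import boolp freeg mpoly ring zify.
Set Implicit Arguments.
Unset Strict Implicit.
Unset Printing Implicit Defensive.
Import Order.TTheory GRing.Theory Num.Theory.
Local Open Scope ring_scope.

(** * The projective line *)

Section ProjectiveLine.
Variable K : fieldType.
Implicit Types (a b : K) (u v w : option K).

(* [option K] is the projective line: [Some c] is (c : 1) and [None] is (1 : 0). *)
Definition hx u : K := if u is Some c then c else 1.
Definition hy u : K := if u is Some _ then 1 else 0.
Definition oinv u : option K :=
  if u is Some c then if c == 0 then None else Some c^-1 else Some 0.
Definition o1m u : option K := omap (fun c => 1 - c) u.
(** The relation u v = w with denominators cleared. It leaves w free when one of u and v is 0 and
    the other infinite. *)
Definition mul3 u v w := hx u * hx v * hy w = hy u * hy v * hx w.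
Definition proj_ratio (a b : K) : option K := if b == 0 then None else Some (a / b).

Lemma oinvK : involutive oinv.
Proof.
case=> [c|] /=; last by rewrite eqxx.
by case: eqVneq => [->|c0] //=; rewrite invr_eq0 (negbTE c0) invrK.
Qed.

Lemma o1mK : involutive o1m.
Proof. by case=> [c|] //=; rewrite subKr. Qed.

Lemma oinvP u v : hx u * hx v = hy u * hy v <-> v = oinv u.
Proof.
case: u => [c|]; case: v => [d|] /=; rewrite ?mulr1 ?mul1r ?mulr0 ?mul0r.
- case: eqVneq => [->|c0]; first by rewrite mul0r; split=> // /esym/eqP; rewrite oner_eq0.
  split=> [cd1|[->]]; last by rewrite divff.
  by congr Some; apply: (mulfI c0); rewrite cd1 divff.
- by case: eqVneq => [->|/eqP c0]; split.
- by split=> [->|[->]].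
- by split=> // /eqP; rewrite oner_eq0.
Qed.

Lemma o1mP u v : hx v * hy u = hy v * (hy u - hx u) <-> v = o1m u.
Proof.
case: u => [c|]; case: v => [d|] /=;
  rewrite ?mulr1 ?mul1r ?mulr0 ?mul0r ?sub0r //.
- by split=> [->|[->]].
- by split=> // /eqP; rewrite oner_eq0.
- by split=> // /eqP; rewrite eq_sym oppr_eq0 oner_eq0.
Qed.

Lemma hxy_neq0 u : hx u = 0 -> hy u = 0 -> False.
Proof. by case: u => [c|] /= => [_ /eqP|/eqP]; rewrite oner_eq0. Qed.

Lemma proj_ratio_rel a b : (a != 0) || (b != 0) -> hx (proj_ratio a b) * b = hy (proj_ratio a b) * a.
Proof.
rewrite /proj_ratio; case: (eqVneq b 0) => [->|b0 _] /=; first by move=> _; rewrite mulr0 mul0r.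
by rewrite mul1r divfK.
Qed.

Lemma ratio_uniq u a b : (a != 0) || (b != 0) -> hx u * b = hy u * a -> u = proj_ratio a b.
Proof.
rewrite /proj_ratio; case: u => [c|] /=; rewrite ?mul1r ?mul0r; last by move=> _ ->; rewrite eqxx.
case: (eqVneq b 0) => [->|b0 _ <-]; last by rewrite mulfK.
by rewrite orbF mulr0 => a0 a0'; rewrite -a0' eqxx in a0.
Qed.

Lemma rel_uniq u v a b : (a != 0) || (b != 0) ->
  hx u * b = hy u * a -> hx v * b = hy v * a -> u = v.
Proof. by move=> ab /(ratio_uniq ab) -> /(ratio_uniq ab) ->. Qed.

Lemma rel_oinv u a b : hx u * b = hy u * a -> hx (oinv u) * a = hy (oinv u) * b.
Proof.
case: u => [c|] /=; last by rewrite !mul1r mul0r.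
rewrite !mul1r; case: eqVneq => [->|c0] /=; first by move=> <-; rewrite mul1r !mul0r.
by move=> <-; rewrite mulKf // mul1r.
Qed.

(** The signs are those produced by [plucker] when the two middle labels of a cross-ratio are
    exchanged. *)
Lemma rel_o1m u a b : hx u * b = hy u * a ->
  hx (o1m u) * (- b) = hy (o1m u) * (a - b).
Proof.
case: u => [c|] /=; first by rewrite !mul1r => <-; ring.
by rewrite !mul1r !mul0r => ->; rewrite oppr0.
Qed.

(* The determinant of the representatives (c, 1) and (1, 0). *)
Definition br u v : K :=
  match u, v with
  | Some c, Some d => c - d | None, Some _ => 1 | Some _, None => - 1 | None, None => 0
  end.

Lemma brN u v : br u v = - br v u.
Proof. by case: u => [c|]; case: v => [d|] /=; rewrite ?opprB ?opprK ?oppr0. Qed.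

Lemma br_eq0 u v : (br u v == 0) = (u == v).
Proof.
case: u => [c|]; case: v => [d|] /=; rewrite ?eqxx ?oppr_eq0 ?oner_eq0 ?subr_eq0 //.
Qed.

Lemma plucker u v w x : br u v * br w x = br u w * br v x - br u x * br v w.
Proof.
by case: u => [a|]; case: v => [b|]; case: w => [c|]; case: x => [d|] /=; ring.
Qed.

End ProjectiveLine.

(** * Cross-ratio systems *)

Section Solutions.
Variables (K : fieldType) (T : finType).
Implicit Types (J : {set T}) (L : {ffun T * T * T * T -> option K}) (s : seq T).

Definition distinct_in J s := uniq s && all (fun x => x \in J) s.

(** Permuted or shortened lists of labels are given by their positions, so that both conditions on
    [idx] are settled by computation. *)
Lemma distinct_in_nth J s x (idx : seq nat) : distinct_in J s -> uniq idx ->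
  all (fun i => i < size s)%N idx -> distinct_in J [seq nth x s i | i <- idx].
Proof.
case/andP=> us sJ ui idxs; apply/andP; split.
  rewrite map_inj_in_uniq // => i j /(allP idxs) /= ilt /(allP idxs) /= jlt.
  by move/eqP; rewrite nth_uniq // => /eqP.
by apply/allP => _ /mapP [i /(allP idxs) /= ilt ->]; apply: (allP sJ); apply: mem_nth.
Qed.

(* Quadruples that are not made of distinct labels of [J] get the dummy value [Some 0]. *)
Record crossratio_sol J L : Prop := CrossratioSol {
  sol_out a b c d : ~~ distinct_in J [:: a; b; c; d] -> L (a, b, c, d) = Some 0;
  sol12 a b c d : distinct_in J [:: a; b; c; d] -> L (b, a, c, d) = oinv (L (a, b, c, d));
  sol34 a b c d : distinct_in J [:: a; b; c; d] -> L (a, b, d, c) = oinv (L (a, b, c, d));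
  sol23 a b c d : distinct_in J [:: a; b; c; d] -> L (a, c, b, d) = o1m (L (a, b, c, d));
  sol_mul a b c d e : distinct_in J [:: a; b; c; d; e] ->
    mul3 (L (a, b, c, d)) (L (a, b, d, e)) (L (a, b, c, e))
}.

(** Exchanging the two pairs is a product of the given transpositions in which the two inversions
    cancel, and then the two maps 1 - l. *)
Lemma sol_swap J L a b c d : crossratio_sol J L -> distinct_in J [:: a; b; c; d] ->
  L (c, d, a, b) = L (a, b, c, d).
Proof.
move=> sL D.
rewrite (sol23 sL (distinct_in_nth a D (idx := [:: 2; 0; 3; 1]) isT isT)) /=.
rewrite (sol12 sL (distinct_in_nth a D (idx := [:: 0; 2; 3; 1]) isT isT)) /=.
rewrite (sol34 sL (distinct_in_nth a D (idx := [:: 0; 2; 1; 3]) isT isT)) /=.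
by rewrite oinvK (sol23 sL D) o1mK.
Qed.

Lemma sol_rev J L a b c d : crossratio_sol J L -> distinct_in J [:: a; b; c; d] ->
  L (d, c, b, a) = L (a, b, c, d).
Proof.
move=> sL D.
rewrite (sol12 sL (distinct_in_nth a D (idx := [:: 2; 3; 1; 0]) isT isT)) /=.
rewrite (sol34 sL (distinct_in_nth a D (idx := [:: 2; 3; 0; 1]) isT isT)) /=.
by rewrite oinvK (sol_swap sL D).
Qed.

Lemma distinct_inC12 J a b c d :
  distinct_in J [:: b; a; c; d] = distinct_in J [:: a; b; c; d].
Proof.
by apply/idP/idP => D; exact: (distinct_in_nth a D (idx := [:: 1; 0; 2; 3]) isT isT).
Qed.

Lemma distinct_inC34 J a b c d :
  distinct_in J [:: a; b; d; c] = distinct_in J [:: a; b; c; d].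
Proof.
by apply/idP/idP => D; exact: (distinct_in_nth a D (idx := [:: 0; 1; 3; 2]) isT isT).
Qed.

Lemma distinct_inC23 J a b c d :
  distinct_in J [:: a; c; b; d] = distinct_in J [:: a; b; c; d].
Proof.
by apply/idP/idP => D; exact: (distinct_in_nth a D (idx := [:: 0; 2; 1; 3]) isT isT).
Qed.

(** [oinv] and [o1m] are injective, so two solutions may be compared after a transposition of the
    labels. *)
Lemma sol_eq_perm J L L' :
  crossratio_sol J L -> crossratio_sol J L' ->
  forall a b c d, distinct_in J [:: a; b; c; d] ->
  [/\ L (b, a, c, d) = L' (b, a, c, d) -> L (a, b, c, d) = L' (a, b, c, d),
      L (a, b, d, c) = L' (a, b, d, c) -> L (a, b, c, d) = L' (a, b, c, d)
    & L (a, c, b, d) = L' (a, c, b, d) -> L (a, b, c, d) = L' (a, b, c, d)].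
Proof.
move=> sL sL' a b c d D; split.
- by rewrite (sol12 sL D) (sol12 sL' D) => /(can_inj (@oinvK K)).
- by rewrite (sol34 sL D) (sol34 sL' D) => /(can_inj (@oinvK K)).
- by rewrite (sol23 sL D) (sol23 sL' D) => /(can_inj (@o1mK K)).
Qed.

End Solutions.

(** * Affine coordinates compatible with a rooted system *)

Section Rooted.
Variables (K : fieldType) (S : finType).
Let T := option S.
Implicit Types (f : S -> K) (L : {ffun T * T * T * T -> option K}).

(* [f] is an affine coordinate of the labels, possibly constant, on some component of the curve
   with the root [None] at infinity. *)
Definition compatible L f := forall b c d, uniq [:: b; c; d] ->
  hx (L (None, Some b, Some c, Some d)) * (f b - f c)
  = hy (L (None, Some b, Some c, Some d)) * (f b - f d).

Definition bracket f (a b : T) : K := br (omap f a) (omap f b).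

(** [L] agrees with the cross-ratio of the images under [f], the root being at infinity, with
    denominators cleared. Nothing is required when three of the labels have the same image. *)
Definition ratio_rel4 L f a b c d :=
  hx (L (a, b, c, d)) * (bracket f a d * bracket f b c)
  = hy (L (a, b, c, d)) * (bracket f a c * bracket f b d).

Lemma distinct_inT (s : seq T) : distinct_in [set: T] s = uniq s.
Proof. by rewrite /distinct_in andb_idr // => _; apply/allP => x; rewrite !inE. Qed.

Section OneSolution.
Variables (L : {ffun T * T * T * T -> option K}) (f : S -> K).
Hypothesis (sL : crossratio_sol [set: T] L).
Local Notation D := (distinct_in [set: T]).

Lemma ratio_rel12 a b c d : D [:: a; b; c; d] -> ratio_rel4 L f a b c d -> ratio_rel4 L f b a c d.
Proof.
move=> Dd; rewrite /ratio_rel4 (sol12 sL Dd) => /rel_oinv.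
by rewrite [bracket f b d * _]mulrC [bracket f b c * _]mulrC.
Qed.

Lemma ratio_rel34 a b c d : D [:: a; b; c; d] -> ratio_rel4 L f a b c d -> ratio_rel4 L f a b d c.
Proof. by move=> Dd; rewrite /ratio_rel4 (sol34 sL Dd) => /rel_oinv. Qed.

Lemma ratio_rel23 a b c d : D [:: a; b; c; d] -> ratio_rel4 L f a b c d -> ratio_rel4 L f a c b d.
Proof.
move=> Dd; rewrite /ratio_rel4 (sol23 sL Dd) => /rel_o1m.
by rewrite /bracket -plucker (brN (omap f c) (omap f b)) !mulrN.
Qed.

Hypothesis fL : compatible L f.

Lemma ratio_rel_root b c d : D [:: None; Some b; Some c; Some d] ->
  ratio_rel4 L f None (Some b) (Some c) (Some d).
Proof.
move=> Dd; rewrite /ratio_rel4 /bracket /= !mul1r fL //.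
have := distinct_in_nth None Dd (idx := [:: 1; 2; 3]) isT isT.
by case/andP=> /= + _; rewrite !inE !negb_or !(inj_eq Some_inj).
Qed.

(** The root r is inserted as an intermediate point: l(a,b,c,r) l(a,b,r,d) = l(a,b,c,d), and both
    factors are known from the compatibility with [f]. *)
Lemma ratio_rel_some a b c d : uniq [:: a; b; c; d] ->
  ratio_rel4 L f (Some a) (Some b) (Some c) (Some d).
Proof.
move=> U.
have Dd : D [:: Some a; Some b; Some c; Some d; None].
  rewrite distinct_inT -[X in uniq X]/([seq Some i | i <- [:: a; b; c; d]] ++ [:: None]).
  by rewrite cat_uniq (map_inj_uniq Some_inj) U.
have R1 : ratio_rel4 L f (Some a) (Some b) (Some c) None.
  rewrite /ratio_rel4; have D1 := distinct_in_nth None Dd (idx := [:: 4; 2; 1; 0]) isT isT.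
  have := ratio_rel_root D1; rewrite /ratio_rel4 (sol_rev sL D1) /bracket /= !mul1r => E.
  by rewrite !(mulrN1, mulN1r, mulrN) -[f b - _]opprB -[f a - _]opprB !mulrN E.
have R2 : ratio_rel4 L f (Some a) (Some b) None (Some d).
  rewrite /ratio_rel4; have D1 := distinct_in_nth None Dd (idx := [:: 4; 3; 0; 1]) isT isT.
  have := ratio_rel_root D1; rewrite /ratio_rel4 (sol_swap sL D1) /bracket /= !mul1r => E.
  by rewrite !(mulrN1, mulN1r, mulrN) -[f a - f d]opprB -[f b - f d]opprB !mulrN !opprK E.
have M := sol_mul sL (distinct_in_nth None Dd (idx := [:: 0; 1; 2; 4; 3]) isT isT).
move: R1 R2 M; rewrite /= /ratio_rel4 /mul3 /bracket /=.
set x1 := L _; set x2 := L _; set x3 := L _ => R1 R2 M.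
have {}R1 : hx x1 * (f b - f c) = hy x1 * (f a - f c).
  by move/eqP: R1; rewrite mulN1r mulrN1 !mulrN eqr_opp => /eqP.
have {}R2 : hx x2 * (f a - f d) = hy x2 * (f b - f d).
  by move/eqP: R2; rewrite mulN1r mulrN1 !mulrN eqr_opp => /eqP.
set P := (f a - f d) * _; set Q := (f a - f c) * _.
have E1 : hx x1 * hx x2 * (hx x3 * P - hy x3 * Q) = 0.
  apply/eqP; rewrite mulrBr subr_eq0; apply/eqP.
  transitivity (hx x3 * (hx x1 * (f b - f c)) * (hx x2 * (f a - f d))); first by rewrite /P; ring.
  rewrite R1 R2; transitivity (hy x1 * hy x2 * hx x3 * Q); first by rewrite /Q; ring.
  by rewrite -M; ring.
have E2 : hy x1 * hy x2 * (hx x3 * P - hy x3 * Q) = 0.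
  apply/eqP; rewrite mulrBr subr_eq0; apply/eqP.
  transitivity (hy x1 * hy x2 * hx x3 * P); first by ring.
  rewrite -M; transitivity (hy x3 * (hx x1 * (f b - f c)) * (hx x2 * (f a - f d))).
    by rewrite /P; ring.
  by rewrite R1 R2 /Q; ring.
(* If neither product of coordinates can be cancelled, one of x1, x2 is 0 and the other infinite;
   then [f] takes the same value at three of the labels and the claim reads 0 = 0. *)
move/eqP: E1; rewrite mulf_eq0 => /orP[|/eqP/subr0_eq //].
move/eqP: E2; rewrite mulf_eq0 => /orP[|/eqP/subr0_eq //].
rewrite !mulf_eq0 => /orP[] /eqP y0 /orP[] /eqP x0.
- by case: (hxy_neq0 x0 y0).
- have bc : f b - f c = 0.
    move: R1; rewrite y0 mul0r => /eqP; rewrite mulf_eq0 => /orP[/eqP x10|/eqP //].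
    by case: (hxy_neq0 x10 y0).
  have bd : f b - f d = 0.
    move: R2; rewrite x0 mul0r => /esym/eqP; rewrite mulf_eq0 => /orP[/eqP y20|/eqP //].
    by case: (hxy_neq0 x0 y20).
  by rewrite /P /Q bc bd !mulr0.
- have ac : f a - f c = 0.
    move: R1; rewrite x0 mul0r => /esym/eqP; rewrite mulf_eq0 => /orP[/eqP y10|/eqP //].
    by case: (hxy_neq0 x0 y10).
  have ad : f a - f d = 0.
    move: R2; rewrite y0 mul0r => /eqP; rewrite mulf_eq0 => /orP[/eqP x20|/eqP //].
    by case: (hxy_neq0 x20 y0).
  by rewrite /P /Q ac ad !mul0r !mulr0.
- by case: (hxy_neq0 x0 y0).
Qed.

(** By the transposition rules the root, if present, is moved to the first place. *)
Lemma compatible_ratio_rel a b c d : D [:: a; b; c; d] -> ratio_rel4 L f a b c d.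
Proof.
move=> Dd.
case: a Dd => [a|] Dd; last first.
  case: b Dd => [b|]; last by rewrite distinct_inT.
  case: c => [c|]; last by rewrite distinct_inT.
  by case: d => [d|]; [exact: ratio_rel_root|rewrite distinct_inT /= ?inE ?eqxx ?orbT ?andbF].
case: b Dd => [b|] Dd; last first.
  rewrite -distinct_inC12 in Dd; apply: ratio_rel12 => //.
  case: c Dd => [c|]; last by rewrite distinct_inT.
  by case: d => [d|]; [exact: ratio_rel_root|rewrite distinct_inT /= ?inE ?eqxx ?orbT ?andbF].
case: c Dd => [c|] Dd; last first.
  have D1 := distinct_in_nth None Dd (idx := [:: 0; 2; 1; 3]) isT isT.
  have D2 := distinct_in_nth None Dd (idx := [:: 2; 0; 1; 3]) isT isT.
  apply: (ratio_rel23 D1); apply: (ratio_rel12 D2).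
  by case: d Dd D2 {D1} => [d|]; [move=> _; exact: ratio_rel_root|
    rewrite distinct_inT /= ?inE ?eqxx ?orbT ?andbF].
case: d Dd => [d|] Dd; last first.
  have D1 := distinct_in_nth None Dd (idx := [:: 0; 1; 3; 2]) isT isT.
  have D2 := distinct_in_nth None Dd (idx := [:: 0; 3; 1; 2]) isT isT.
  have D3 := distinct_in_nth None Dd (idx := [:: 3; 0; 1; 2]) isT isT.
  by apply: (ratio_rel34 D1); apply: (ratio_rel23 D2); apply: (ratio_rel12 D3); exact: ratio_rel_root.
apply: ratio_rel_some.
by move: Dd; rewrite distinct_inT -(map_inj_uniq Some_inj).
Qed.

(* A point outside a cluster is seen from inside the cluster in the same direction as the root. *)
Lemma sol_outlier a b c d : uniq [:: a; b; c; d] -> f a = f b -> f a != f d ->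
  L (Some a, Some b, Some c, Some d) = L (Some a, Some b, Some c, None).
Proof.
move=> U fab fad.
have Dd : D [:: Some a; Some b; Some c; Some d; None].
  rewrite distinct_inT -[X in uniq X]/([seq Some i | i <- [:: a; b; c; d]] ++ [:: None]).
  by rewrite cat_uniq (map_inj_uniq Some_inj) U.
have M := sol_mul sL (distinct_in_nth None Dd (idx := [:: 0; 1; 2; 4; 3]) isT isT).
have R := compatible_ratio_rel (distinct_in_nth None Dd (idx := [:: 0; 1; 4; 3]) isT isT).
have {}R : L (Some a, Some b, None, Some d) = Some 1.
  apply: rel_uniq R _; rewrite /bracket /= -fab.
    by rewrite mulN1r oppr_eq0 subr_eq0 fad.
  by ring.
move: M; rewrite /= R /mul3 /= mulr1 mulr1.
case: (L _) (L _) => [u|] [v|] //=; rewrite ?mulr1 ?mul1r ?mulr0 ?mul0r //.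
- by move->.
- by move/esym/eqP; rewrite oner_eq0.
- by move/eqP; rewrite oner_eq0.
Qed.

End OneSolution.
End Rooted.

(** * Screens seen from the root *)

Section Screens.
Variables (K : fieldType) (S : finType).
Let T := option S.
Variables (L : {ffun T * T * T * T -> option K}).
Hypothesis (sL : crossratio_sol [set: T] L).
Hypothesis (S2 : (1 < #|S|)%N).

Lemma uniq_root (s : seq S) : uniq s -> distinct_in [set: T] (None :: [seq Some i | i <- s]).
Proof.
move=> U; rewrite distinct_inT /= (map_inj_uniq Some_inj) U andbT.
by apply/mapP => -[].
Qed.

Lemma distinct_root (s : seq S) : distinct_in [set: T] (None :: [seq Some i | i <- s]) -> uniq s.
Proof. by rewrite distinct_inT /= (map_inj_uniq Some_inj) => /andP[]. Qed.

(* Widest cluster: among all pairs, take one whose screen sees the most labels at finite distance. *)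
Lemma exists_top_pair : exists2 bc : S * S, bc.1 != bc.2 &
  forall d, L (None, Some bc.1, Some bc.2, Some d) != None.
Proof.
have [x [y [_ _ xy]]] := card_gt1P S2.
pose C (bc : S * S) := [set d | L (None, Some bc.1, Some bc.2, Some d) != None].
pose P (bc : S * S) := bc.1 != bc.2.
case: (@arg_maxnP _ (x, y) P (fun bc => #|C bc|) xy) => -[b c]; rewrite {}/P /= => bc maxbc.
exists (b, c) => //= d; apply/negP => /eqP Ld.
have out e s : ~~ uniq (s ++ [:: e]) -> size s = 2%N ->
    L (None, Some (nth e s 0), Some (nth e s 1), Some e) = Some 0.
  case: s => [|x0 [|x1 [|//]]] //= U _; apply: (sol_out sL).
  by apply: contraNN U => /(distinct_root (s := [:: x0; x1; e])).
have U : uniq [:: b; c; d].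
  by apply/negPn/negP => U; have := out d [:: b; c] U erefl; rewrite /= Ld.
have D := uniq_root U.
have bd : b != d by move: U; rewrite /= !inE negb_or => /andP[/andP[]].
(* By maximality [(b, d)] cannot see more labels than [(b, c)]; but it sees every label that
   [(b, c)] sees, and [d] in addition. *)
have /= := maxbc (b, d) bd.
apply/negP; rewrite -ltnNge; apply: proper_card; apply/properP; split.
  apply/subsetP => e; rewrite !inE /= => Le.
  have [->|eb] := eqVneq e b.
    by rewrite (out b [:: b; d]) //= !inE eqxx orbT.
  have [->|ed] := eqVneq e d.
    by rewrite (out d [:: b; d]) //= !inE eqxx andbF.
  have [->|ec] := eqVneq e c.
    by rewrite (sol34 sL D) Ld.
  have U4 : uniq [:: b; c; d; e].
    move: U; rewrite /= !inE !negb_or => /andP[/andP[-> ->]] /andP[-> _].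
    by rewrite !(eq_sym _ e) eb ed ec.
  have := sol_mul sL (uniq_root U4); rewrite /mul3 Ld /= mul0r mul0r mul1r.
  case: (L (None, Some b, Some c, Some e)) Le => //= v _.
  case: (L _) => //= /eqP; by rewrite mulr1 oner_eq0.
exists d; rewrite !inE /= ?Ld //.
by rewrite (out d [:: b; d]) //= !inE eqxx andbF.
Qed.

Section TopScreen.
Variables (b c : S).
Hypothesis (bc : b != c) (top : forall d, L (None, Some b, Some c, Some d) != None).

(** The coordinate with value 0 at b and 1 at c. The value at c has to be prescribed, while at b the
    dummy value [Some 0] is the right one. *)
Definition top_screen d : K :=
  if d == c then 1 else hx (L (None, Some b, Some c, Some d)).

Let f := top_screen.
Local Notation R := (ratio_rel4 L f None).
Local Notation D := (distinct_in [set: T]).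

Lemma top_screen_b : f b = 0.
Proof.
rewrite /f /top_screen (negbTE bc) (sol_out sL) //.
by apply/negP => /(distinct_root (s := [:: b; c; b])); rewrite /= !inE eqxx orbT.
Qed.

Lemma top_screen_c : f c = 1. Proof. by rewrite /f /top_screen eqxx. Qed.

Lemma top_screenE d : d != c -> L (None, Some b, Some c, Some d) = Some (f d).
Proof. by move=> dc; have := top d; rewrite /f /top_screen (negbTE dc); case: (L _). Qed.

(** The product relation l(r,b,c,g) l(r,b,g,h) = l(r,b,c,h), with r the root, has the known terms f
    g on the left and f h on the right. *)
Lemma top_screen_rel_b g h : uniq [:: b; g; h] -> R (Some b) (Some g) (Some h).
Proof.
move=> U; have Dd := uniq_root U.
(* [top_screenE] needs a label other than [c]; the inversion rule exchanges g and h. *)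
wlog hc : g h U Dd / h != c.
  move=> W; have [hc|/W] := eqVneq h c; last by apply.
  have Ds := distinct_in_nth None Dd (idx := [:: 0; 1; 3; 2]) isT isT.
  apply: (ratio_rel34 sL Ds); apply: W => //.
    by move: (distinct_root (s := [:: b; h; g]) Ds).
  by move: U; rewrite -hc /= !inE => /andP[_ /andP[]].
rewrite /ratio_rel4 /bracket /= !mul1r top_screen_b !sub0r.
have [gc|gc] := eqVneq g c.
  by rewrite gc top_screenE // top_screen_c /= mul1r mulrN1.
have U4 : uniq [:: b; c; g; h].
  move: U; rewrite /= !inE !negb_or => /andP[/andP[-> ->]] /andP[-> _].
  by rewrite bc eq_sym gc eq_sym hc.
have := sol_mul sL (uniq_root U4); rewrite /mul3 !top_screenE //= mul1r mulr1 => M.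
by rewrite !mulrN -M mulrC.
Qed.

(** In the product relation l(r,e,b,g) l(r,e,g,h) = l(r,e,b,h) the values containing b are known,
    and they are finite because [f e] is nonzero, so their denominators cancel. *)
Lemma top_screen_rel_neq0 e g h : uniq [:: e; g; h] -> f e != 0 ->
  b \notin [:: e; g; h] -> R (Some e) (Some g) (Some h).
Proof.
move=> U fe nb.
have U4 : uniq [:: b; e; g; h] by rewrite cons_uniq nb.
have Dd := uniq_root U4.
have M := sol_mul sL (distinct_in_nth None Dd (idx := [:: 0; 2; 1; 3; 4]) isT isT).
have Rg : R (Some e) (Some b) (Some g).
  apply: (ratio_rel23 sL (distinct_in_nth None Dd (idx := [:: 0; 1; 2; 3]) isT isT)).
  apply: top_screen_rel_b.
  exact: (distinct_root (distinct_in_nth None Dd (idx := [:: 0; 1; 2; 3]) isT isT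
    : D (None :: [seq Some i | i <- [:: b; e; g]]))).
have Rh : R (Some e) (Some b) (Some h).
  apply: (ratio_rel23 sL (distinct_in_nth None Dd (idx := [:: 0; 1; 2; 4]) isT isT)).
  apply: top_screen_rel_b.
  exact: (distinct_root (distinct_in_nth None Dd (idx := [:: 0; 1; 2; 4]) isT isT
    : D (None :: [seq Some i | i <- [:: b; e; h]]))).
move: M Rg Rh; rewrite /mul3 /ratio_rel4 /bracket /= !mul1r top_screen_b !subr0.
set u1 := L _; set u2 := L _; set u3 := L _ => M R1 R3.
have y_neq0 u z : hx u * f e = hy u * z -> hy u != 0.
  move=> E; apply/eqP => y0; move/eqP: E; rewrite y0 mul0r mulf_eq0 (negbTE fe) orbF => /eqP x0.
  exact: hxy_neq0 x0 y0.
apply: (mulfI (y_neq0 _ _ R1)); apply: (mulfI (y_neq0 _ _ R3)).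
transitivity (hx u2 * hy u3 * (hy u1 * (f e - f g))); first by ring.
rewrite -R1; transitivity (hx u1 * hx u2 * hy u3 * f e); first by ring.
rewrite M; transitivity (hy u1 * hy u2 * (hx u3 * f e)); first by ring.
by rewrite R3; ring.
Qed.

(** The condition is stable under permutations of the three labels: b, or else a label of nonzero
    value, is put first. If all three values are 0, the condition is trivial. *)
Lemma top_screen_compatible : compatible L f.
Proof.
move=> e g h U; have Dd := uniq_root U.
suff : R (Some e) (Some g) (Some h) by rewrite /ratio_rel4 /bracket /= !mul1r.
have D1 := distinct_in_nth None Dd (idx := [:: 0; 2; 1; 3]) isT isT.
have D2 := distinct_in_nth None Dd (idx := [:: 0; 3; 1; 2]) isT isT.
have D3 := distinct_in_nth None Dd (idx := [:: 0; 1; 3; 2]) isT isT.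
have U1 := distinct_root (D1 : D (None :: [seq Some i | i <- [:: g; e; h]])).
have U2 := distinct_root (D2 : D (None :: [seq Some i | i <- [:: h; e; g]])).
have W1 : R (Some g) (Some e) (Some h) -> R (Some e) (Some g) (Some h).
  exact: (ratio_rel23 sL D1).
have W2 : R (Some h) (Some e) (Some g) -> R (Some e) (Some g) (Some h).
  by move=> /(ratio_rel23 sL D2) /(ratio_rel34 sL D3).
case: (boolP (b \in [:: e; g; h])) => [|nb].
  rewrite !inE => /or3P[] /eqP E.
  - by rewrite -E; apply: top_screen_rel_b; rewrite E.
  - by apply: W1; rewrite -E; apply: top_screen_rel_b; rewrite E.
  - by apply: W2; rewrite -E; apply: top_screen_rel_b; rewrite E.
have [e0|e0] := eqVneq (f e) 0; last exact: top_screen_rel_neq0.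
have [g0|g0] := eqVneq (f g) 0; last first.
  by apply/W1/top_screen_rel_neq0 => //; move: nb; rewrite !inE orbCA.
have [h0|h0] := eqVneq (f h) 0; last first.
  by apply/W2/top_screen_rel_neq0 => //; move: nb; rewrite !inE orbA orbC.
by rewrite /ratio_rel4 /bracket /= e0 g0 h0 subrr !mulr0.
Qed.

(** Comparing d with b and c shows that the values at b and c determine [g]; conversely, affine
    images stay compatible. Hence the dimension two. *)
Lemma compatible_affine (g : S -> K) : compatible L g <->
  forall d, g d = g b + (g c - g b) * f d.
Proof.
split=> [gL d|gE e h k U].
  have [->|dc] := eqVneq d c; first by rewrite top_screen_c; ring.
  have [->|db] := eqVneq d b; first by rewrite top_screen_b; ring.
  have := gL b c d; rewrite top_screenE //= !inE negb_or bc eq_sym db eq_sym dc.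
  move=> /(_ isT); rewrite mul1r => E.
  by apply: (addrI (- g b)); rewrite -opprB addrC -(opprB (g b)) -E; ring.
have := top_screen_compatible U; set u := L _ => E.
rewrite (gE e) (gE h) (gE k).
transitivity ((g c - g b) * (hx u * (f e - f h))); first by ring.
by rewrite E; ring.
Qed.

End TopScreen.
End Screens.

Lemma card_compatible (K : finFieldType) (S : finType)
    (L : {ffun option S * option S * option S * option S -> option K}) :
  crossratio_sol [set: option S] L -> (1 < #|S|)%N ->
  #|[set f : {ffun S -> K} | `[< compatible L f >]]| = (#|K| ^ 2)%N.
Proof.
move=> sL S2; have [[b c] /= bc top] := exists_top_pair sL S2.
pose F (xy : K * K) : {ffun S -> K} := [ffun d => xy.1 + (xy.2 - xy.1) * top_screen L b c d].
have Fb xy : F xy b = xy.1 by rewrite ffunE top_screen_b // mulr0 addr0.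
have Fc xy : F xy c = xy.2 by rewrite ffunE top_screen_c // mulr1 addrC subrK.
have Finj : injective F.
  move=> [x y] [x' y'] E; have := Fb (x, y); have := Fc (x, y).
  by rewrite E Fb Fc /= => -> ->.
rewrite expnS expn1 -card_prod -(card_imset predT Finj); apply: eq_card => g.
rewrite !inE; apply/asboolP/imsetP => [/(compatible_affine sL bc top) gE|[xy _ ->]].
  by exists (g b, g c) => //; apply/ffunP => d; rewrite ffunE /=.
by apply/(compatible_affine sL bc top) => d; rewrite Fb Fc ffunE.
Qed.

(** * Gluing cross-ratio systems along a screen *)

Section Clusters.
Variables (K : finFieldType) (S : finType) (f : {ffun S -> K}).
Let T := option S.
Local Notation lab := (omap f).
Local Notation funs := {ffun T * T * T * T -> option K}.

Definition cluster (y : K) : {set T} := [set a | if a is Some s then f s == y else true].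
(** Seen from inside a cluster, every label outside it lies in the direction of the root. *)
Definition retract y (a : T) : T := if lab a == Some y then a else None.
(** The root counts as an outsider, so every list of distinct labels of [cluster y] is major for
    [y]. *)
Definition major y (s : seq T) := (count (fun a => lab a != Some y) s <= 1)%N.

Definition restrict (J : {set T}) (L : funs) : funs :=
  [ffun t => let: (a, b, c, d) := t in
     if distinct_in J [:: a; b; c; d] then L t else Some 0].

Lemma restrict_sol J L : crossratio_sol [set: T] L -> crossratio_sol J (restrict J L).
Proof.
move=> sL.
have up s : distinct_in J s -> distinct_in [set: T] s.
  by rewrite distinct_inT => /andP[].
split=> [a b c d D|a b c d D|a b c d D|a b c d D|a b c d e D]; rewrite !ffunE.
- by rewrite (negbTE D).
- by rewrite distinct_inC12 D; apply: (sol12 sL (up _ D)).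
- by rewrite distinct_inC34 D; apply: (sol34 sL (up _ D)).
- by rewrite distinct_inC23 D; apply: (sol23 sL (up _ D)).
rewrite (distinct_in_nth a D (idx := [:: 0; 1; 2; 3]) isT isT).
rewrite (distinct_in_nth a D (idx := [:: 0; 1; 3; 4]) isT isT).
rewrite (distinct_in_nth a D (idx := [:: 0; 1; 2; 4]) isT isT).
exact: (sol_mul sL (up _ D)).
Qed.

Lemma in_cluster y a : (a \in cluster y) = (a == None) || (lab a == Some y).
Proof. by case: a => [a|]; rewrite inE. Qed.

Lemma retract_in y a : retract y a \in cluster y.
Proof. by rewrite in_cluster /retract; case: ifP => [->|]; rewrite ?orbT. Qed.

Lemma retract_id y a : a \in cluster y -> retract y a = a.
Proof. by rewrite in_cluster /retract; case: (lab a == _) => //; rewrite orbF => /eqP. Qed.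

Lemma retract_distinct y s : uniq s -> major y s ->
  distinct_in (cluster y) (map (retract y) s).
Proof.
move=> U M; apply/andP; split; last by apply/allP => _ /mapP [a _ ->]; exact: retract_in.
rewrite map_inj_in_uniq // => a b aS bS; rewrite /retract.
case: ifP => la; case: ifP => lb //.
- by move=> ab; rewrite ab in la.
- by move=> ab; rewrite -ab in lb.
move=> _; have : {subset [:: a; b] <= [seq x <- s | lab x != Some y]}.
  by move=> x; rewrite !inE mem_filter => /orP[] /eqP ->; rewrite ?la ?lb ?aS ?bS.
move: M; rewrite /major -size_filter.
case: [seq x <- s | _] => [|x [|//]] _ sub.
  by have := sub a; rewrite !inE eqxx => /(_ isT).
have := sub a; have := sub b; rewrite !inE !eqxx orbT => /(_ isT) /eqP -> /(_ isT) /eqP ->.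
by [].
Qed.

Lemma cluster_distinct_major y s : distinct_in (cluster y) s -> major y s.
Proof.
case/andP=> U /allP sy; rewrite /major -size_filter.
apply: (uniq_leq_size (s2 := [:: None])); first exact: filter_uniq.
move=> x; rewrite mem_filter inE => /andP[nx /sy]; rewrite in_cluster.
by rewrite (negbTE nx) orbF.
Qed.

(** An entry lies outside at least one of two distinct fibres, so a list that is major for both has
    at most two entries. *)
Lemma major_uniq y z s : (2 < size s)%N -> major y s -> major z s -> y = z.
Proof.
move=> s3 My Mz; apply/eqP/negPn/negP => yz.
have := count_predUI (fun a => lab a != Some y) (fun a => lab a != Some z) s.
rewrite [X in (X + _)%N](_ : _ = size s); last first.
  apply/eqP; rewrite -all_count; apply/allP => x _ /=.
  apply/negPn/negP; rewrite negb_or !negbK => /andP[/eqP -> /eqP [E]].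
  by rewrite E eqxx in yz.
move: My Mz; rewrite /major; lia.
Qed.

Lemma two_two_not_major y a b c d : count (fun a => lab a == Some y) [:: a; b; c; d] = 2%N ->
  forall z, ~~ major z [:: a; b; c; d].
Proof.
rewrite /major => cnt z; rewrite -ltnNge; have [<-|yz] := eqVneq y z.
  have : (2 + count (fun a => lab a != Some y) [:: a; b; c; d] = 4)%N.
    rewrite -[in LHS]cnt -[RHS]/(size [:: a; b; c; d]).
    by rewrite -(count_predC (fun a => lab a == Some y)).
  by case: (count _ _) => [|[|n]].
rewrite -cnt; apply: sub_count => x /= /eqP ->.
by apply: contraNneq yz => -[->].
Qed.

(** If both products vanish, three of the labels have the same image; it is finite since the root
    occurs only once, so the quadruple is major. *)
Lemma not_major_ratio a b c d : uniq [:: a; b; c; d] -> (forall y, ~~ major y [:: a; b; c; d]) ->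
  (bracket f a c * bracket f b d != 0) || (bracket f a d * bracket f b c != 0).
Proof.
move=> U nm; rewrite -negb_and !mulf_eq0 !br_eq0; apply/negP.
have lS x z : x != z -> lab x = lab z -> exists y, lab x = Some y.
  by case: x => [x|]; case: z => [z|] //= _ _; eexists.
move: U; rewrite /= !inE !negb_or => /and4P[/and3P[ab ac ad] /andP[bc bd] cd _].
case/andP=> /orP[] /eqP E1 /orP[] /eqP E2.
- have [y Ey] := lS _ _ ac E1; have := nm y.
  by rewrite /major /= -E1 -E2 Ey eqxx /=; case: (lab b != _).
- have [y Ey] := lS _ _ ac E1; have := nm y.
  by rewrite /major /= E2 -E1 Ey eqxx /=; case: (lab d != _).
- have [y Ey] := lS _ _ ad E2; have := nm y.
  by rewrite /major /= E1 -E2 Ey eqxx /=; case: (lab c != _).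
- have [y Ey] := lS _ _ bd E1; have := nm y.
  by rewrite /major /= -E2 -E1 Ey eqxx /=; case: (lab a != _).
Qed.

(* Inverse of the restriction map: a quadruple with at least three labels in one cluster is read
   off inside that cluster, the other label being replaced by the root; all the other quadruples
   take the cross-proj_ratio of their values under the screen [f]. *)
Definition glue (mu : {ffun K -> funs}) : funs :=
  [ffun t => let: (a, b, c, d) := t in
     if uniq [:: a; b; c; d] then
       if [pick y | major y [:: a; b; c; d]] is Some y
       then mu y (retract y a, retract y b, retract y c, retract y d)
       else proj_ratio (bracket f a c * bracket f b d)%R (bracket f a d * bracket f b c)%R
     else Some 0].

Section Glue.
Variable mu : {ffun K -> funs}.
Hypothesis smu : forall y, crossratio_sol (cluster y) (mu y).
Local Notation L := (glue mu).

Lemma glue_major y a b c d : uniq [:: a; b; c; d] -> major y [:: a; b; c; d] ->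
  L (a, b, c, d) = mu y (retract y a, retract y b, retract y c, retract y d).
Proof.
move=> U M; rewrite ffunE U; case: pickP => [z Mz|/(_ y)]; last by rewrite M.
by rewrite (major_uniq _ M Mz).
Qed.

Lemma glue_not_major a b c d : uniq [:: a; b; c; d] -> (forall y, ~~ major y [:: a; b; c; d]) ->
  L (a, b, c, d) = proj_ratio (bracket f a c * bracket f b d) (bracket f a d * bracket f b c).
Proof.
by move=> U nM; rewrite ffunE U; case: pickP => // z; rewrite (negbTE (nM z)).
Qed.

Lemma majorC12 y a b c d : major y [:: b; a; c; d] = major y [:: a; b; c; d].
Proof. by rewrite /major /= addnCA. Qed.

Lemma majorC34 y a b c d : major y [:: a; b; d; c] = major y [:: a; b; c; d].
Proof. by rewrite /major /= (addnCA (lab d != _)). Qed.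

Lemma majorC23 y a b c d : major y [:: a; c; b; d] = major y [:: a; b; c; d].
Proof. by rewrite /major /= (addnCA (lab c != _)). Qed.

Lemma glue_ratio_rel a b c d : uniq [:: a; b; c; d] ->
  (forall y, ~~ major y [:: a; b; c; d]) -> ratio_rel4 L f a b c d.
Proof.
by move=> U nM; rewrite /ratio_rel4 (glue_not_major U nM); apply/proj_ratio_rel/not_major_ratio.
Qed.

Lemma glue_inf a b c d : uniq [:: a; b; c; d] -> (forall y, ~~ major y [:: a; b; c; d]) ->
  lab a = lab d \/ lab b = lab c -> L (a, b, c, d) = None.
Proof.
move=> U nM E; rewrite (glue_not_major U nM) /proj_ratio ifT //.
by rewrite mulf_eq0 !br_eq0; case: E => ->; rewrite eqxx ?orbT.
Qed.

Lemma glue_0 a b c d : uniq [:: a; b; c; d] -> (forall y, ~~ major y [:: a; b; c; d]) ->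
  lab a = lab c \/ lab b = lab d -> L (a, b, c, d) = Some 0.
Proof.
move=> U nM E; rewrite (glue_not_major U nM).
have E0 : bracket f a c * bracket f b d = 0.
  by apply/eqP; rewrite mulf_eq0 !br_eq0; case: E => ->; rewrite eqxx ?orbT.
have := not_major_ratio U nM.
by rewrite /proj_ratio E0 eqxx mul0r => /negbTE ->.
Qed.

Lemma glue_1 a b c d : uniq [:: a; b; c; d] -> (forall y, ~~ major y [:: a; b; c; d]) ->
  lab a = lab b \/ lab c = lab d -> L (a, b, c, d) = Some 1.
Proof.
move=> U nM E; rewrite (glue_not_major U nM).
have E1 : bracket f a c * bracket f b d = bracket f a d * bracket f b c.
  by rewrite /bracket; case: E => ->; rewrite 1?mulrC.
have := not_major_ratio U nM; rewrite /proj_ratio E1 orbb => nz.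
by rewrite (negbTE nz) divff.
Qed.

Lemma glue_sol12 a b c d : uniq [:: a; b; c; d] -> L (b, a, c, d) = oinv (L (a, b, c, d)).
Proof.
move=> U; have U' : uniq [:: b; a; c; d] by rewrite -distinct_inT distinct_inC12 distinct_inT.
case: (pickP (fun y => major y [:: a; b; c; d])) => [y M|nM].
  rewrite (glue_major U' (y := y)); last by rewrite majorC12.
  rewrite (glue_major U M).
  exact: (sol12 (smu y) (retract_distinct U M)).
have {}nM y : ~~ major y [:: a; b; c; d] by rewrite nM.
have nM' y : ~~ major y [:: b; a; c; d] by rewrite majorC12.
apply: rel_uniq (not_major_ratio U' nM') (glue_ratio_rel U' nM') _.
have /rel_oinv := glue_ratio_rel U nM.
by rewrite [bracket f b d * _]mulrC [bracket f b c * _]mulrC.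
Qed.

Lemma glue_sol34 a b c d : uniq [:: a; b; c; d] -> L (a, b, d, c) = oinv (L (a, b, c, d)).
Proof.
move=> U; have U' : uniq [:: a; b; d; c] by rewrite -distinct_inT distinct_inC34 distinct_inT.
case: (pickP (fun y => major y [:: a; b; c; d])) => [y M|nM].
  rewrite (glue_major U' (y := y)); last by rewrite majorC34.
  rewrite (glue_major U M).
  exact: (sol34 (smu y) (retract_distinct U M)).
have {}nM y : ~~ major y [:: a; b; c; d] by rewrite nM.
have nM' y : ~~ major y [:: a; b; d; c] by rewrite majorC34.
apply: rel_uniq (not_major_ratio U' nM') (glue_ratio_rel U' nM') _.
by have /rel_oinv := glue_ratio_rel U nM.
Qed.

Lemma glue_sol23 a b c d : uniq [:: a; b; c; d] -> L (a, c, b, d) = o1m (L (a, b, c, d)).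
Proof.
move=> U; have U' : uniq [:: a; c; b; d] by rewrite -distinct_inT distinct_inC23 distinct_inT.
case: (pickP (fun y => major y [:: a; b; c; d])) => [y M|nM].
  rewrite (glue_major U' (y := y)); last by rewrite majorC23.
  rewrite (glue_major U M).
  exact: (sol23 (smu y) (retract_distinct U M)).
have {}nM y : ~~ major y [:: a; b; c; d] by rewrite nM.
have nM' y : ~~ major y [:: a; c; b; d] by rewrite majorC23.
apply: rel_uniq (not_major_ratio U' nM') (glue_ratio_rel U' nM') _.
have /rel_o1m := glue_ratio_rel U nM.
by rewrite /bracket -plucker (brN (lab c) (lab b)) !mulrN.
Qed.

Lemma ratio_scale (p q : K) : (p != 0) || (q != 0) ->
  exists s, hx (proj_ratio p q) = s * p /\ hy (proj_ratio p q) = s * q.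
Proof.
rewrite /proj_ratio; have [->|q0] := eqVneq q 0.
  by rewrite orbF => p0; exists p^-1; rewrite mulVf // mulr0.
by move=> _; exists q^-1; rewrite mulVf // mulrC.
Qed.

(** The argument depends on how many of the five labels share a fibre: if never more than two, all
    values are cross-ratios of the screen; if four or more, the relation holds in the cluster; if
    exactly three, there are ten cases. *)
Lemma glue_sol_mul a b c d e : uniq [:: a; b; c; d; e] ->
  mul3 (L (a, b, c, d)) (L (a, b, d, e)) (L (a, b, c, e)).
Proof.
move=> U.
have sub idx : uniq idx -> all (fun i => i < 5)%N idx ->
    uniq [seq nth a [:: a; b; c; d; e] i | i <- idx].
  have U' : distinct_in [set: T] [:: a; b; c; d; e] by rewrite distinct_inT.
  by move=> ui si; have := distinct_in_nth a U' ui si; rewrite distinct_inT.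
have U1 : uniq [:: a; b; c; d] := sub [:: 0; 1; 2; 3]%N isT isT.
have U2 : uniq [:: a; b; d; e] := sub [:: 0; 1; 3; 4]%N isT isT.
have U3 : uniq [:: a; b; c; e] := sub [:: 0; 1; 2; 4]%N isT isT.
case: (pickP (fun y => 2 < count (fun x => lab x == Some y) [:: a; b; c; d; e])%N) => [y|none]; last first.
  have nM s x : perm_eq (x :: s) [:: a; b; c; d; e] -> size s = 4%N -> forall z, ~~ major z s.
    move=> pe s4 z; apply/negP => M; have := none z.
    rewrite -(permP pe) /= => /negP; apply; apply: ltn_addl.
    have := count_predC (fun x => lab x == Some z) s; rewrite s4.
    move: M; rewrite /major -[count (fun x => lab x != _) s]/(count (predC (fun x => lab x == Some z)) s).
    by move: (count _ _) (count (predC _) _) => m n; lia.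
  have nM1 := nM [:: a; b; c; d] e; have nM2 := nM [:: a; b; d; e] c.
  have nM3 := nM [:: a; b; c; e] d.
  have {}nM1 z : ~~ major z [:: a; b; c; d].
    by apply: nM1 => //; rewrite -[X in perm_eq _ X]/([:: a; b; c; d] ++ [:: e]) perm_sym perm_catC.
  have {}nM2 z : ~~ major z [:: a; b; d; e].
    by apply: nM2 => //; rewrite -[X in perm_eq _ X]/([:: a; b] ++ [:: c] ++ [:: d; e]) perm_sym perm_catCA.
  have {}nM3 z : ~~ major z [:: a; b; c; e].
    by apply: nM3 => //; rewrite -[X in perm_eq _ X]/([:: a; b; c] ++ [:: d] ++ [:: e]) perm_sym perm_catCA.
  rewrite (glue_not_major U1 nM1) (glue_not_major U2 nM2) (glue_not_major U3 nM3) /mul3.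
  have [s1 [-> ->]] := ratio_scale (not_major_ratio U1 nM1).
  have [s2 [-> ->]] := ratio_scale (not_major_ratio U2 nM2).
  have [s3 [-> ->]] := ratio_scale (not_major_ratio U3 nM3).
  ring.
have four : major y [:: a; b; c; d; e] -> mul3 (L (a, b, c, d)) (L (a, b, d, e)) (L (a, b, c, e)).
  move=> M; have D := retract_distinct U M.
  have sM p q r s : (count (fun x => lab x != Some y) [:: p; q; r; s] 
      <= count (fun x => lab x != Some y) [:: a; b; c; d; e])%N -> major y [:: p; q; r; s].
    by move=> le; apply: leq_trans le M.
  rewrite (glue_major U1 (y := y)); last by apply: sM; rewrite /= !leq_add2l ?leq_addl.
  rewrite (glue_major U2 (y := y)); last by apply: sM; rewrite /= !leq_add2l ?leq_addl.
  rewrite (glue_major U3 (y := y)); last by apply: sM; rewrite /= !leq_add2l ?leq_addl.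
  exact: (sol_mul (smu y) D).
have nM p q r s :
    ((lab p == Some y) + ((lab q == Some y) + ((lab r == Some y) + ((lab s == Some y) + 0))) = 2)%N ->
  forall z, ~~ major z [:: p; q; r; s] by exact: two_two_not_major.
have maj p q r s :
    ((lab p != Some y) + ((lab q != Some y) + ((lab r != Some y) + ((lab s != Some y) + 0))) = 1)%N ->
  major y [:: p; q; r; s] by rewrite /major /= => ->.
have eq_lab p q : (lab p == Some y) = true -> (lab q == Some y) = true -> lab p = lab q.
  by move=> /eqP -> /eqP ->.
rewrite /= => cnt.
(* With exactly three labels in the fibre, a quadruple contains all three and is read in the
   cluster, or contains two and takes one of the values 0, 1 and infinity. The relation then is
   trivial, an equality or an inversion. *)
case Ea: (lab a == Some y) cnt; case Eb: (lab b == Some y); case Ec: (lab c == Some y);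
case Ed: (lab d == Some y); case Ee: (lab e == Some y) => // _;
try by apply: four; rewrite /major /= Ea Eb Ec Ed Ee.
- rewrite (glue_major U1 (maj _ _ _ _ _)); last by rewrite Ea Eb Ec Ed.
  rewrite (glue_1 U2 (nM _ _ _ _ _) (or_introl (eq_lab _ _ Ea Eb))); last by rewrite Ea Eb Ed Ee.
  rewrite (glue_major U3 (maj _ _ _ _ _)); last by rewrite Ea Eb Ec Ee.
  by rewrite /retract Ea Eb Ec Ed Ee /mul3 /= !mulr1 mulrC.
- rewrite (glue_major U1 (maj _ _ _ _ _)); last by rewrite Ea Eb Ec Ed.
  rewrite (glue_major U2 (maj _ _ _ _ _)); last by rewrite Ea Eb Ed Ee.
  rewrite (glue_1 U3 (nM _ _ _ _ _) (or_introl (eq_lab _ _ Ea Eb))); last by rewrite Ea Eb Ec Ee.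
  rewrite /retract Ea Eb Ec Ed Ee; have := retract_distinct U1 (maj _ _ _ _ _).
  rewrite /= /retract Ea Eb Ec Ed => /(_ erefl)/(sol34 (smu y)) ->.
  by rewrite /mul3 /= !mulr1; apply/oinvP.
- rewrite (glue_1 U1 (nM _ _ _ _ _) (or_introl (eq_lab _ _ Ea Eb))); last by rewrite Ea Eb Ec Ed.
  rewrite (glue_major U2 (maj _ _ _ _ _)); last by rewrite Ea Eb Ed Ee.
  rewrite (glue_major U3 (maj _ _ _ _ _)); last by rewrite Ea Eb Ec Ee.
  by rewrite /retract Ea Eb Ec Ed Ee /mul3 /= !mul1r mulrC.
- rewrite (glue_major U1 (maj _ _ _ _ _)); last by rewrite Ea Eb Ec Ed.
  rewrite (glue_0 U2 (nM _ _ _ _ _) (or_introl (eq_lab _ _ Ea Ed))); last by rewrite Ea Eb Ed Ee.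
  rewrite (glue_0 U3 (nM _ _ _ _ _) (or_introl (eq_lab _ _ Ea Ec))); last by rewrite Ea Eb Ec Ee.
  by rewrite /mul3 /= ?(mulr0, mul0r).
- rewrite (glue_0 U1 (nM _ _ _ _ _) (or_introl (eq_lab _ _ Ea Ec))); last by rewrite Ea Eb Ec Ed.
  rewrite (glue_inf U2 (nM _ _ _ _ _) (or_introl (eq_lab _ _ Ea Ee))); last by rewrite Ea Eb Ed Ee.
  rewrite (glue_major U3 (maj _ _ _ _ _)); last by rewrite Ea Eb Ec Ee.
  by rewrite /mul3 /= ?(mulr0, mul0r).
- rewrite (glue_inf U1 (nM _ _ _ _ _) (or_introl (eq_lab _ _ Ea Ed))); last by rewrite Ea Eb Ec Ed.
  rewrite (glue_major U2 (maj _ _ _ _ _)); last by rewrite Ea Eb Ed Ee.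
  rewrite (glue_inf U3 (nM _ _ _ _ _) (or_introl (eq_lab _ _ Ea Ee))); last by rewrite Ea Eb Ec Ee.
  by rewrite /mul3 /= ?(mulr0, mul0r).
- rewrite (glue_major U1 (maj _ _ _ _ _)); last by rewrite Ea Eb Ec Ed.
  rewrite (glue_inf U2 (nM _ _ _ _ _) (or_intror (eq_lab _ _ Eb Ed))); last by rewrite Ea Eb Ed Ee.
  rewrite (glue_inf U3 (nM _ _ _ _ _) (or_intror (eq_lab _ _ Eb Ec))); last by rewrite Ea Eb Ec Ee.
  by rewrite /mul3 /= ?(mulr0, mul0r).
- rewrite (glue_inf U1 (nM _ _ _ _ _) (or_intror (eq_lab _ _ Eb Ec))); last by rewrite Ea Eb Ec Ed.
  rewrite (glue_0 U2 (nM _ _ _ _ _) (or_intror (eq_lab _ _ Eb Ee))); last by rewrite Ea Eb Ed Ee.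
  rewrite (glue_major U3 (maj _ _ _ _ _)); last by rewrite Ea Eb Ec Ee.
  by rewrite /mul3 /= ?(mulr0, mul0r).
- rewrite (glue_0 U1 (nM _ _ _ _ _) (or_intror (eq_lab _ _ Eb Ed))); last by rewrite Ea Eb Ec Ed.
  rewrite (glue_major U2 (maj _ _ _ _ _)); last by rewrite Ea Eb Ed Ee.
  rewrite (glue_0 U3 (nM _ _ _ _ _) (or_intror (eq_lab _ _ Eb Ee))); last by rewrite Ea Eb Ec Ee.
  by rewrite /mul3 /= ?(mulr0, mul0r).
- rewrite (glue_1 U1 (nM _ _ _ _ _) (or_intror (eq_lab _ _ Ec Ed))); last by rewrite Ea Eb Ec Ed.
  rewrite (glue_1 U2 (nM _ _ _ _ _) (or_intror (eq_lab _ _ Ed Ee))); last by rewrite Ea Eb Ed Ee.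
  rewrite (glue_1 U3 (nM _ _ _ _ _) (or_intror (eq_lab _ _ Ec Ee))); last by rewrite Ea Eb Ec Ee.
  by rewrite /mul3 /= !mulr1.
Qed.

Lemma glue_sol : crossratio_sol [set: T] L.
Proof.
split=> [a b c d|a b c d|a b c d|a b c d|a b c d e]; rewrite distinct_inT.
- by move=> /negbTE U; rewrite ffunE U.
- exact: glue_sol12.
- exact: glue_sol34.
- exact: glue_sol23.
- exact: glue_sol_mul.
Qed.

Lemma glue_compatible : compatible L f.
Proof.
move=> b c d U; have /andP[U' _] := uniq_root U.
case: (pickP (fun y => major y (None :: [seq Some i | i <- [:: b; c; d]]))) => [y|nM]; last first.
  have {}nM y : ~~ major y [:: None; Some b; Some c; Some d] by have /negbT := nM y.
  by have := glue_ratio_rel U' nM; rewrite /ratio_rel4 /bracket /= !mul1r.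
(* The root is the one outsider allowed, so b, c and d lie in the same fibre. *)
rewrite /major /= => M; suff [-> ->] : f b = f d /\ f c = f d by rewrite subrr !mulr0.
have inj x z : (Some x == Some z :> option K) = (x == z) by [].
move: M; rewrite !inj; case: (eqVneq (f b) y) => [->|//]; case: (eqVneq (f c) y) => [->|//].
by case: (eqVneq (f d) y) => [->|//].
Qed.

Lemma restrict_glue y : restrict (cluster y) L = mu y.
Proof.
apply/ffunP => -[[[a b] c] d]; rewrite ffunE; case: ifPn => D; last by rewrite (sol_out (smu y) D).
have /andP[U /and5P[aJ bJ cJ dJ _]] := D.
by rewrite (glue_major U (cluster_distinct_major D)) !retract_id.
Qed.
End Glue.

(** The screen determines the value at a quadruple unless three labels have the same image. These
    are then moved to the front; the fourth label is in the cluster or, by [sol_outlier], may be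
    replaced by the root. *)
Lemma restrict_inj L L' : crossratio_sol [set: T] L -> crossratio_sol [set: T] L' ->
  compatible L f -> compatible L' f ->
  (forall y, restrict (cluster y) L = restrict (cluster y) L') -> L = L'.
Proof.
move=> sL sL' fL fL' LL'.
have in_clus y a b c d : distinct_in (cluster y) [:: a; b; c; d] -> L (a, b, c, d) = L' (a, b, c, d).
  by move=> D; move/ffunP: (LL' y) => /(_ (a, b, c, d)); rewrite !ffunE D.
have triple a b c d : uniq [:: a; b; c; d] -> lab a = lab b -> lab a = lab c ->
    L (a, b, c, d) = L' (a, b, c, d).
  move=> U; case: a U => [a|] U; last first.
    by case: b U => [b|//]; rewrite /= !inE.
  case: b U => [b|//] U; case: c U => [c|//] U /= [fab] [fac].
  case: d U => [d|] U; last first.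
    by apply: (in_clus (f a)); rewrite /distinct_in U /= !inE -fab -fac eqxx.
  have [fad|fad] := eqVneq (f a) (f d).
    by apply: (in_clus (f a)); rewrite /distinct_in U /= !inE -fab -fac -fad eqxx.
  have US : uniq [:: a; b; c; d].
    by move: U; rewrite -[X in uniq X]/[seq Some i | i <- [:: a; b; c; d]] (map_inj_uniq Some_inj).
  rewrite (sol_outlier sL fL US fab fad) (sol_outlier sL' fL' US fab fad).
  apply: (in_clus (f a)); rewrite /distinct_in /= !inE -fab -fac !eqxx !andbT /=.
  by move: US; rewrite /= !inE !negb_or !(inj_eq Some_inj) => /and4P[/and3P[-> -> _] /andP[-> _]].
apply/ffunP => -[[[a b] c] d].
have [U|nU] := boolP (uniq [:: a; b; c; d]); last first.
  by rewrite (sol_out sL) ?(sol_out sL') // distinct_inT.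
have D : distinct_in [set: T] [:: a; b; c; d] by rewrite distinct_inT.
have [nz|] := boolP ((bracket f a c * bracket f b d != 0) || (bracket f a d * bracket f b c != 0)).
  exact: rel_uniq nz (compatible_ratio_rel sL fL D) (compatible_ratio_rel sL' fL' D).
rewrite negb_or !negbK !mulf_eq0 !br_eq0 => /andP[] /orP[] /eqP E1 /orP[] /eqP E2.
- have D1 := distinct_in_nth a D (idx := [:: 0; 2; 1; 3]) isT isT.
  have D2 := distinct_in_nth a D (idx := [:: 0; 2; 3; 1]) isT isT.
  have [_ _ W1] := sol_eq_perm sL sL' D; have [_ W2 _] := sol_eq_perm sL sL' D1.
  by apply: W1; apply: W2; apply: triple => //; rewrite -distinct_inT.
- by apply: triple => //; rewrite E1 ?E2.
- have D1 := distinct_in_nth a D (idx := [:: 0; 1; 3; 2]) isT isT.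
  have [_ W1 _] := sol_eq_perm sL sL' D.
  by apply: W1; apply: triple; rewrite -?distinct_inT // ?E1 ?E2.
- have D1 := distinct_in_nth a D (idx := [:: 3; 2; 1; 0]) isT isT.
  rewrite -(sol_rev sL D) -(sol_rev sL' D).
  by apply: triple; rewrite -?distinct_inT // -?E1 ?E2.
Qed.

End Clusters.

Definition crossratio_sols (K : finFieldType) (T : finType) (J : {set T}) :
    {set {ffun T * T * T * T -> option K}} := [set L | `[< crossratio_sol J L >]].

(** Restriction to the clusters is injective on the solutions compatible with [f], and [glue] is a
    right inverse. *)
Lemma card_compatible_sols (K : finFieldType) (S : finType) (f : {ffun S -> K}) :
  #|[set L in crossratio_sols K [set: option S] | `[< compatible L f >]]|
  = (\prod_(y : K) #|crossratio_sols K (cluster f y)|)%N.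
Proof.
pose Phi (L : {ffun option S * option S * option S * option S -> option K}) :=
  [ffun y : K => restrict (cluster f y) L].
transitivity #|family (fun y => mem (crossratio_sols K (cluster f y)))|; last first.
  by rewrite card_family foldrE big_map big_enum.
rewrite -(card_in_imset (f := Phi)); last first.
  move=> L L'; rewrite !inE => /andP[/asboolP sL /asboolP fL] /andP[/asboolP sL' /asboolP fL'].
  move/ffunP=> E; apply: (restrict_inj sL sL' fL fL') => y.
  by have := E y; rewrite !ffunE.
apply: eq_card => mu; apply/imsetP/familyP => [[L + ->] y|smu].
  rewrite inE => /andP[]; rewrite inE => /asboolP sL _.
  by rewrite ffunE inE; apply/asboolP/restrict_sol.
have {}smu y : crossratio_sol (cluster f y) (mu y) by have := smu y; rewrite !inE => /asboolP.
exists (glue f mu); last by apply/ffunP => y; rewrite ffunE restrict_glue.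
rewrite !inE; apply/andP; split; apply/asboolP; [exact: glue_sol|exact: glue_compatible].
Qed.

(** * The recursion for the number of cross-ratio systems *)

(** Relabelling along the enumerations of J and J'. Because of the dummy values outside J, the
    ambient type does not affect the count. *)
Lemma leq_card_sols (K : finFieldType) (T T' : finType) (J : {set T}) (J' : {set T'}) x0 :
  x0 \in J -> #|J| = #|J'| -> (#|crossratio_sols K J| <= #|crossratio_sols K J'|)%N.
Proof.
move=> x0J JJ'.
pose h x := nth x0 (enum J) (index x (enum J')).
have hJ x : x \in J' -> h x \in J.
  by move=> xJ'; rewrite -mem_enum mem_nth // -cardE JJ' cardE index_mem mem_enum.
have hD s : distinct_in J' s -> distinct_in J (map h s).
  case/andP=> U /allP sJ'; apply/andP; split; last first.
    by apply/allP => _ /mapP [x /sJ' xJ' ->]; apply: hJ.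
  rewrite map_inj_in_uniq // => x y /sJ' xJ' /sJ' yJ' /eqP.
  rewrite nth_uniq ?enum_uniq // -?cardE ?JJ' ?cardE ?index_mem ?mem_enum //.
  by move/eqP/(congr1 (nth x (enum J'))); rewrite !nth_index ?mem_enum.
pose F (L : {ffun T * T * T * T -> option K}) : {ffun T' * T' * T' * T' -> option K} :=
  [ffun t => let: (a, b, c, d) := t in
     if distinct_in J' [:: a; b; c; d] then L (h a, h b, h c, h d) else Some 0].
have x0' : exists x0', x0' \in J' by apply/card_gt0P; rewrite -JJ'; apply/card_gt0P; exists x0.
case: x0' => x0' x0J'; pose k x := nth x0' (enum J') (index x (enum J)).
have kJ x : x \in J -> k x \in J'.
  by move=> xJ; rewrite -mem_enum mem_nth // -cardE -JJ' cardE index_mem mem_enum.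
have hk x : x \in J -> h (k x) = x.
  move=> xJ; rewrite /h /k index_uniq ?enum_uniq ?nth_index ?mem_enum //.
  by rewrite -cardE -JJ' cardE index_mem mem_enum.
rewrite -(card_in_imset (f := F)); last first.
  move=> L1 L2; rewrite !inE => /asboolP s1 /asboolP s2 /ffunP E.
  apply/ffunP => -[[[a b] c] d].
  have [D|nD] := boolP (distinct_in J [:: a; b; c; d]); last first.
    by rewrite (sol_out s1 nD) (sol_out s2 nD).
  have := E (k a, k b, k c, k d); rewrite !ffunE.
  have /andP[U /and5P[aJ bJ cJ dJ _]] := D.
  have D' : distinct_in J' [:: k a; k b; k c; k d].
    apply/andP; split; last by rewrite /= !kJ.
    apply: (@map_uniq _ _ h); move: U; congr (is_true (uniq _)).
    by rewrite /= !hk.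
  by rewrite D' !hk.
apply: subset_leq_card; apply/subsetP => _ /imsetP [L + ->].
rewrite !inE => /asboolP sL; apply/asboolP.
split=> [a b c d D|a b c d D|a b c d D|a b c d D|a b c d e D]; rewrite !ffunE.
- by rewrite (negbTE D).
- by rewrite distinct_inC12 D; apply: (sol12 sL (hD _ D)).
- by rewrite distinct_inC34 D; apply: (sol34 sL (hD _ D)).
- by rewrite distinct_inC23 D; apply: (sol23 sL (hD _ D)).
rewrite (distinct_in_nth a D (idx := [:: 0; 1; 2; 3]) isT isT).
rewrite (distinct_in_nth a D (idx := [:: 0; 1; 3; 4]) isT isT).
rewrite (distinct_in_nth a D (idx := [:: 0; 1; 2; 4]) isT isT).
exact: (sol_mul sL (hD _ D)).
Qed.

Lemma card_sols (K : finFieldType) (T T' : finType) (J : {set T}) (J' : {set T'}) :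
  (0 < #|J|)%N -> #|J| = #|J'| -> #|crossratio_sols K J| = #|crossratio_sols K J'|.
Proof.
move=> J0 JJ'; have J0' : (0 < #|J'|)%N by rewrite -JJ'.
have [x xJ] := card_gt0P J0; have [x' xJ'] := card_gt0P J0'.
by apply/eqP; rewrite eqn_leq (leq_card_sols _ xJ) // (leq_card_sols _ xJ').
Qed.

Definition nb_sols (K : finFieldType) (n : nat) : nat := #|crossratio_sols K [set: 'I_n]|.

Lemma card_sols_le3 (K : finFieldType) n : (n <= 3)%N -> nb_sols K n = 1%N.
Proof.
move=> n3; have nD (s : seq 'I_n) : (3 < size s)%N -> ~~ distinct_in [set: 'I_n] s.
  move=> s4; apply/negP => /andP[/uniq_leq_size us _].
  have := us (enum 'I_n) (fun x _ => mem_enum _ x); rewrite size_enum_ord.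
  by rewrite leqNgt (leq_ltn_trans n3).
apply/eqP/cards1P; exists [ffun=> Some 0]; apply/setP => L; rewrite !inE.
apply/asboolP/eqP => [sL|->].
  by apply/ffunP => -[[[a b] c] d]; rewrite ffunE (sol_out sL) // nD.
split=> [a b c d|a b c d D|a b c d D|a b c d D|a b c d e D]; first by rewrite ffunE.
all: by move: D; rewrite (negbTE (nD _ _)).
Qed.

(** Pairs of a solution and a compatible function are counted in two ways. The successors account
    for the root, in the whole set and in each fibre. *)
Lemma nb_sols_rec (K : finFieldType) n : (1 < n)%N ->
  (#|K| ^ 2 * nb_sols K n.+1
   = \sum_(f : {ffun 'I_n -> K}) \prod_(y : K) nb_sols K #|f @^-1: [set y]|.+1)%N.
Proof.
move=> n1; pose X := crossratio_sols K [set: option 'I_n].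
have -> : nb_sols K n.+1 = #|X|.
  by apply: card_sols; rewrite ?cardsT ?card_option !card_ord.
have -> : (#|K| ^ 2 * #|X| = \sum_(L in X) #|[set f : {ffun 'I_n -> K} | `[< compatible L f >]]|)%N.
  rewrite (eq_bigr (fun=> #|K| ^ 2)%N) ?sum_nat_const 1?mulnC // => L.
  by rewrite inE => /asboolP sL; rewrite (card_compatible sL) ?card_ord.
rewrite (eq_bigr (fun L => \sum_(f : {ffun 'I_n -> K} | `[< compatible L f >]) 1%N)); last first.
  by move=> L _; rewrite sum1_card cardsE.
rewrite (exchange_big_dep predT) //=; apply: eq_bigr => f _.
transitivity (#|[set L in X | `[< compatible L f >]]|).
  by rewrite -sum1_card; apply: eq_bigl => L; rewrite !inE.
rewrite card_compatible_sols; apply: eq_bigr => y _; apply: card_sols.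
  by apply/card_gt0P; exists None; rewrite inE.
transitivity #|Some @: (f @^-1: [set y])|.+1; last by rewrite cardsT card_ord (card_imset _ Some_inj).
rewrite (cardsD1 (None : option 'I_n) (cluster f y)) in_cluster eqxx add1n; congr _.+1.
apply: eq_card => -[i|]; rewrite !inE /=.
  by rewrite mem_imset ?inE //; exact: Some_inj.
by apply/esym/imsetP => -[].
Qed.

(** * Counting points in the Grothendieck group *)

Section PointCount.
Variable K : finFieldType.

Definition zeros n (I : seq {mpoly K[n]}) : {set {ffun 'I_n -> K}} :=
  [set v : {ffun 'I_n -> K} | all (fun p : {mpoly K[n]} => p.@[v] == 0) I].

Definition nb_points (X : affine K) : nat := #|zeros (tagged X)|.

Lemma zerosP n (I : seq {mpoly K[n]}) (v : {ffun 'I_n -> K}) :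
  reflect (forall p, p \in I -> p.@[v] = 0) (v \in zeros I).
Proof. by rewrite inE; apply: (iffP allP) => H p /H /eqP. Qed.

Lemma in_ideal_zeros n (I : seq {mpoly K[n]}) (v : {ffun 'I_n -> K}) p :
  v \in zeros I -> in_ideal I p -> p.@[v] = 0.
Proof.
move=> /zerosP Iv [c ->]; rewrite raddf_sum big1 // => i _ /=.
by rewrite mevalM (Iv I`_i) ?mulr0 // mem_nth.
Qed.

(** The polynomials [phi] define a map on points, injective because [psi] undoes it on the zeros. *)
Lemma nb_points_iso_le (X Y : affine K) : affine_iso X Y -> (nb_points X <= nb_points Y)%N.
Proof.
case: X Y => [n I] [m J] [phi [psi [/= phiI psiI phiK psiK]]].
pose F (v : {ffun 'I_n -> K}) := [ffun j => (tnth phi j).@[v]] : {ffun 'I_m -> K}.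
rewrite /nb_points /= -(card_in_imset (f := F)).
  apply: subset_leq_card; apply/subsetP => _ /imsetP [v vI ->].
  apply/zerosP => p pJ; have := in_ideal_zeros vI (phiI p pJ).
  by rewrite comp_mpoly_meval => pv; rewrite -[RHS]pv; apply: meval_eq => j; rewrite ffunE.
move=> v w vI wI /ffunP E; apply/ffunP => i.
have vE u : u \in zeros I -> u i = (tnth psi i).@[fun j => (tnth phi j).@[u]].
  move=> uI; have := in_ideal_zeros uI (phiK i).
  by rewrite mevalB mevalXU comp_mpoly_meval => /eqP; rewrite subr_eq0 => /eqP.
rewrite (vE v vI) (vE w wI); apply: meval_eq => j.
by have := E j; rewrite !ffunE.
Qed.

Lemma nb_points_iso (X Y : affine K) : affine_iso X Y -> nb_points X = nb_points Y.
Proof.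
move=> XY; have YX : affine_iso Y X by case: XY => phi [psi [? ? ? ?]]; exists psi, phi.
by apply/eqP; rewrite eqn_leq !nb_points_iso_le.
Qed.

Lemma meval_mwiden n (p : {mpoly K[n]}) (v : 'I_n.+1 -> K) :
  (mwiden p).@[v] = p.@[fun i => v (widen_ord (leqnSn n) i)].
Proof.
rewrite [RHS]mevalE [in LHS](mpolyE p) (big_morph _ (@mwidenD _ _) (@mwiden0 _ _)).
rewrite (big_morph _ (mevalD v) (meval0 v)).
apply: eq_bigr => m _; rewrite mwidenZ mevalZ mwidenX mevalX big_ord_recr /=.
rewrite mnmwiden_ordmax expr0 mulr1; congr (_ * _); apply: eq_bigr => i _.
by rewrite mnmwiden_widen.
Qed.

Lemma nb_points_cut n (I : seq {mpoly K[n]}) p :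
  nb_points (Affine I) = (nb_points (closed_part I p) + nb_points (open_part I p))%N.
Proof.
rewrite /nb_points /= -(cardsID [set v : {ffun 'I_n -> K} | p.@[v] == 0]); congr (_ + _)%N.
  by apply: eq_card => v; rewrite !inE andbC.
(* On the open part the additional coordinate is forced to be the inverse of p(v). *)
pose F (v : {ffun 'I_n -> K}) : {ffun 'I_n.+1 -> K} :=
  [ffun i => oapp v (p.@[v])^-1 (unlift ord_max i)].
have widenE (i : 'I_n) : widen_ord (leqnSn n) i = fintype.lift ord_max i.
  by apply: val_inj; rewrite /= /bump leqNgt ltn_ord.
have Fw v i : F v (widen_ord (leqnSn n) i) = v i by rewrite ffunE widenE liftK.
have Fm v : F v ord_max = (p.@[v])^-1 by rewrite ffunE unlift_none.
have Finj : injective F by move=> v w E; apply/ffunP => i; rewrite -!Fw E.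
have Fwid v (r : {mpoly K[n]}) : (mwiden r).@[F v] = r.@[v].
  by rewrite meval_mwiden; apply: meval_eq => i; exact: Fw.
rewrite -(card_imset _ Finj); apply: eq_card => w; apply/imsetP/zerosP => [[v + ->] r|wz].
  rewrite !inE => /andP[pv /allP vI] /orP[/eqP ->|/mapP [s sI ->]].
    by rewrite mevalB mevalM meval1 mevalXU Fwid Fm mulfV ?subrr.
  by rewrite Fwid; apply/eqP/vI.
pose v : {ffun 'I_n -> K} := [ffun i => w (widen_ord (leqnSn n) i)].
have wwid (r : {mpoly K[n]}) : (mwiden r).@[w] = r.@[v].
  by rewrite meval_mwiden; apply: meval_eq => i; rewrite ffunE.
have /eqP : p.@[v] * w ord_max = 1.
  have := wz (1 - mwiden p * 'X_ord_max); rewrite inE eqxx => /(_ isT) /eqP.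
  by rewrite mevalB mevalM meval1 mevalXU wwid subr_eq0 eq_sym => /eqP.
have [->|pv /eqP pw] := eqVneq p.@[v] 0; first by rewrite mul0r eq_sym oner_eq0.
exists v.
  rewrite !inE pv; apply/allP => r rI; rewrite -wwid; apply/eqP/wz.
  by rewrite inE map_f ?orbT.
apply/ffunP => i; case: (unliftP ord_max i) => [j|] ->.
  by rewrite -widenE Fw ffunE.
by rewrite Fm; apply: (mulfI pv); rewrite pw mulfV.
Qed.

Definition point_count (a : {freeg (affine K) / int}) : int :=
  fglift (fun X => (nb_points X)%:Z : int^o) a.

Lemma point_count_is_zmod : zmod_morphism point_count.
Proof. exact: (@lift_is_additive _ (affine K) int^o). Qed.
HB.instance Definition _ :=
  GRing.isZmodMorphism.Build {freeg (affine K) / int} int point_count point_count_is_zmod.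

Lemma point_countU k X : point_count << k *g X >> = k * (nb_points X)%:Z.
Proof. by rewrite /point_count liftU. Qed.

Lemma point_count_null a : K0_null a -> point_count a = 0.
Proof.
elim=> {a} [|a b _ a0 _ b0|X Y XY|n I p]; first exact: raddf0.
- by rewrite raddfB /= a0 b0 subrr.
- by rewrite raddfB /= !point_countU (nb_points_iso XY) subrr.
- by rewrite !raddfB /= !point_countU (nb_points_cut I p) !mul1r PoszD addrAC addrK subrr.
Qed.

Lemma point_count_eq a b : K0_eq a b -> point_count a = point_count b.
Proof. by move/point_count_null/eqP; rewrite raddfB subr_eq0 => /eqP. Qed.

Lemma point_count_horner P : point_count (K0_horner K P) = P.[#|K|%:R].
Proof.
rewrite raddf_sum horner_coef; apply: eq_bigr => j _ /=; rewrite point_countU; congr (_ * _).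
rewrite /nb_points (_ : zeros _ = setT); last by apply/setP => v; rewrite !inE.
by rewrite cardsT card_ffun card_ord -natrX natz.
Qed.

End PointCount.

Lemma all_comprehensionP (T : finType) (A : Type) (F : T -> A) (C : pred T) (P : pred A) :
  reflect (forall t, C t -> P (F t)) (all P [seq F t | t <- enum T & C t]).
Proof.
rewrite all_map all_filter; apply: (iffP allP) => [H t Ct|H t _ /=].
  by have := H t (mem_enum _ t); rewrite /= Ct.
by apply/implyP/H.
Qed.

(** * Points of the cells of the moduli space *)

Section CellCount.
Variables (K : finFieldType) (n : nat).
Local Notation T := 'I_n.
Local Notation funs := {ffun T * T * T * T -> option K}.
Local Notation N := #|{: quad n}|.

Definition value_at (L : funs) (t : 4.-tuple T) : option K :=
  L (tnth t 0, tnth t 1, tnth t 2, tnth t 3).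

Lemma tuple4_eta (t : 4.-tuple T) : t = [tuple tnth t 0; tnth t 1; tnth t 2; tnth t 3].
Proof. by case: t => [[|a [|b [|c [|d [|]]]]]] //= i; apply: val_inj. Qed.

Definition crossratio_of_cell (S : {set quad n}) (v : {ffun 'I_N -> K}) : funs :=
  [ffun u => let: (a, b, c, d) := u in
     if insub [tuple a; b; c; d] is Some q then
       if (q : quad n) \in S then None else Some (v (enum_rank q))
     else Some 0].

Lemma crossratio_of_cellE S v (q : quad n) : value_at (crossratio_of_cell S v) (val q)
  = if q \in S then None else Some (v (enum_rank q)).
Proof. by rewrite /value_at ffunE -tuple4_eta valK. Qed.

Lemma eval_cell (S : {set quad n}) (v : {ffun 'I_N -> K}) (t : 4.-tuple T) : uniq t ->
  (cell_x K S t).@[v] = hx (value_at (crossratio_of_cell S v) t)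
  /\ (cell_y K S t).@[v] = hy (value_at (crossratio_of_cell S v) t).
Proof.
move=> ut; rewrite /cell_x /cell_y; have -> : t = val (Sub t ut : quad n) by rewrite SubK.
rewrite valK crossratio_of_cellE; case: ifP => _; rewrite ?meval1 ?meval0 //.
by rewrite mevalXU.
Qed.

Lemma zeros_cell (S : {set quad n}) (v : {ffun 'I_N -> K}) :
  (v \in zeros (tagged (Mbar_cell K S))) =
  (crossratio_of_cell S v \in crossratio_sols K [set: T]) && [forall q in S, v (enum_rank q) == 0].
Proof.
set L := crossratio_of_cell S v; rewrite !inE all_cat; congr (_ && _); last first.
  rewrite all_map; apply/allP/forall_inP => H q qS.
    by have := H q; rewrite mem_enum qS /= mevalXU => /(_ isT).
  by rewrite /= mevalXU; apply: H; rewrite mem_enum in qS.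
have XE (a b c d : T) : uniq [:: a; b; c; d] ->
    (cell_x K S [tuple a; b; c; d]).@[v] = hx (L (a, b, c, d)).
  by move=> U; have [-> _] := eval_cell S v (t := [tuple a; b; c; d]) U.
have YE (a b c d : T) : uniq [:: a; b; c; d] ->
    (cell_y K S [tuple a; b; c; d]).@[v] = hy (L (a, b, c, d)).
  by move=> U; have [_ ->] := eval_cell S v (t := [tuple a; b; c; d]) U.
have DU (s : seq T) : distinct_in [set: T] s = uniq s.
  by rewrite /distinct_in andb_idr // => _; apply/allP => x; rewrite !inE.
have C12 (a b c d : T) : uniq [:: b; a; c; d] = uniq [:: a; b; c; d].
  by have := distinct_inC12 [set: T] a b c d; rewrite !DU.
have C34 (a b c d : T) : uniq [:: a; b; d; c] = uniq [:: a; b; c; d].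
  by have := distinct_inC34 [set: T] a b c d; rewrite !DU.
have C23 (a b c d : T) : uniq [:: a; c; b; d] = uniq [:: a; b; c; d].
  by have := distinct_inC23 [set: T] a b c d; rewrite !DU.
have C5 (a b c d e : T) : uniq [:: a; b; c; d; e] ->
    [/\ uniq [:: a; b; c; d], uniq [:: a; b; d; e] & uniq [:: a; b; c; e]].
  rewrite -DU => D.
  have /andP[U1 _] := distinct_in_nth a D (idx := [:: 0; 1; 2; 3]%N) isT isT.
  have /andP[U2 _] := distinct_in_nth a D (idx := [:: 0; 1; 3; 4]%N) isT isT.
  by have /andP[U3 _] := distinct_in_nth a D (idx := [:: 0; 1; 2; 4]%N) isT isT.
have E12 (a b c d : T) : uniq [:: a; b; c; d] ->
    (cell_x K S [tuple a; b; c; d] * cell_x K S [tuple b; a; c; d]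
     - cell_y K S [tuple a; b; c; d] * cell_y K S [tuple b; a; c; d]).@[v] == 0 <->
    L (b, a, c, d) = oinv (L (a, b, c, d)).
  move=> U; have U' : uniq [:: b; a; c; d] by rewrite C12.
  rewrite mevalB !mevalM (XE _ _ _ _ U) (XE _ _ _ _ U') (YE _ _ _ _ U) (YE _ _ _ _ U') subr_eq0.
  by rewrite -oinvP; split=> /eqP.
have E34 (a b c d : T) : uniq [:: a; b; c; d] ->
    (cell_x K S [tuple a; b; c; d] * cell_x K S [tuple a; b; d; c]
     - cell_y K S [tuple a; b; c; d] * cell_y K S [tuple a; b; d; c]).@[v] == 0 <->
    L (a, b, d, c) = oinv (L (a, b, c, d)).
  move=> U; have U' : uniq [:: a; b; d; c] by rewrite C34.
  rewrite mevalB !mevalM (XE _ _ _ _ U) (XE _ _ _ _ U') (YE _ _ _ _ U) (YE _ _ _ _ U') subr_eq0.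
  by rewrite -oinvP; split=> /eqP.
have E23 (a b c d : T) : uniq [:: a; b; c; d] ->
    (cell_x K S [tuple a; c; b; d] * cell_y K S [tuple a; b; c; d]
     - cell_y K S [tuple a; c; b; d]
       * (cell_y K S [tuple a; b; c; d] - cell_x K S [tuple a; b; c; d])).@[v] == 0 <->
    L (a, c, b, d) = o1m (L (a, b, c, d)).
  move=> U; have U' : uniq [:: a; c; b; d] by rewrite C23.
  rewrite mevalB !mevalM mevalB.
  rewrite (XE _ _ _ _ U) (XE _ _ _ _ U') (YE _ _ _ _ U) (YE _ _ _ _ U') subr_eq0.
  by rewrite -o1mP; split=> /eqP.
have Emul (a b c d e : T) : uniq [:: a; b; c; d; e] ->
    (cell_x K S [tuple a; b; c; d] * cell_x K S [tuple a; b; d; e] * cell_y K S [tuple a; b; c; e]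
     - cell_y K S [tuple a; b; c; d] * cell_y K S [tuple a; b; d; e]
       * cell_x K S [tuple a; b; c; e]).@[v] == 0 <->
    mul3 (L (a, b, c, d)) (L (a, b, d, e)) (L (a, b, c, e)).
  move=> /C5 [U1 U2 U3]; rewrite mevalB !mevalM.
  rewrite (XE _ _ _ _ U1) (XE _ _ _ _ U2) (XE _ _ _ _ U3).
  rewrite (YE _ _ _ _ U1) (YE _ _ _ _ U2) (YE _ _ _ _ U3) subr_eq0.
  by split=> /eqP.
rewrite /crossratio_eqs !all_cat.
apply/and4P/asboolP => [[]|sL].
  move=> /all_comprehensionP H1 /all_comprehensionP H2 /all_comprehensionP H3 /all_comprehensionP H4.
  split=> [a b c d|a b c d|a b c d|a b c d|a b c d e]; rewrite DU => U.
  - by rewrite ffunE insubF //; apply/negbTE.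
  - by apply/E12 => //; have := H1 [tuple a; b; c; d] U.
  - by apply/E34 => //; have := H2 [tuple a; b; c; d] U.
  - by apply/E23 => //; have := H3 [tuple a; b; c; d] U.
  - by apply/Emul => //; have := H4 [tuple a; b; c; d; e] U.
split; apply/all_comprehensionP => -[[|a [|b [|c [|d s]]]] //= sz].
- case: s sz => //= sz U; rewrite /tnth /=; apply/E12 => //; apply: (sol12 sL); by rewrite DU.
- case: s sz => //= sz U; rewrite /tnth /=; apply/E34 => //; apply: (sol34 sL); by rewrite DU.
- case: s sz => //= sz U; rewrite /tnth /=; apply/E23 => //; apply: (sol23 sL); by rewrite DU.
case: s sz => [//|e [|//]] sz U; rewrite /tnth /=; apply/Emul => //; apply: (sol_mul sL).
by rewrite DU.
Qed.

(** The cells partition the solutions according to the set of quadruples where the value is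
    infinite. *)
Lemma card_Mbar_cells :
  (\sum_(S : {set quad n}) nb_points (Mbar_cell K S))%N = nb_sols K n.
Proof.
pose infinite (L : funs) : {set quad n} := [set q | value_at L (val q) == None].
rewrite /nb_sols -sum1_card (partition_big infinite predT) //=; apply: eq_bigr => S _.
rewrite sum1_card /nb_points.
have infE (v : {ffun 'I_N -> K}) : infinite (crossratio_of_cell S v) = S.
  by apply/setP => q; rewrite inE crossratio_of_cellE; case: (q \in S).
rewrite -(card_in_imset (f := crossratio_of_cell S)); last first.
  move=> v w; rewrite !zeros_cell => /andP[_ /forall_inP v0] /andP[_ /forall_inP w0] vw.
  apply/ffunP => i; rewrite -(enum_valK i); set q := enum_val i.
  have [qS|qS] := boolP (q \in S); first by rewrite (eqP (v0 q qS)) (eqP (w0 q qS)).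
  have := crossratio_of_cellE S v q; rewrite vw crossratio_of_cellE (negbTE qS).
  by move=> [->].
apply: eq_card => L; apply/imsetP/andP => [[v + ->]|[sL /eqP LS]].
  by rewrite zeros_cell infE => /andP[-> _].
have {}sL' : crossratio_sol [set: T] L by move: sL; rewrite inE => /asboolP.
pose v : {ffun 'I_N -> K} := [ffun i =>
  if value_at L (val (enum_val i : quad n)) is Some x then x else 0].
have vq q : v (enum_rank q) = if value_at L (val q) is Some x then x else 0.
  by rewrite ffunE enum_rankK.
have Lv : L = crossratio_of_cell S v.
  apply/ffunP => -[[[a b] c] d]; rewrite ffunE; case: insubP => [q _ qE|nU]; last first.
    by rewrite (sol_out sL') // /distinct_in (negbTE nU).
  have LE : L (a, b, c, d) = value_at L (val q) by rewrite qE.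
  by rewrite -LS inE vq LE; case: (value_at L (val q)).
exists v => //; rewrite zeros_cell -Lv sL /=; apply/forall_inP => q.
by rewrite -LS inE vq => /eqP ->.
Qed.

Lemma point_count_Mbar : point_count (Mbar_class K n) = (nb_sols K n)%:Z.
Proof.
rewrite raddf_sum -card_Mbar_cells.
rewrite (eq_bigr (fun S : {set quad n} => (nb_points (Mbar_cell K S))%:Z)) => [|S _].
  by rewrite -natz natr_sum; apply: eq_bigr => S _; rewrite natz.
by rewrite /= point_countU mul1r.
Qed.

End CellCount.

Lemma Mbar_class_poly_count (K : finFieldType) n P : is_Mbar_class_poly n P ->
  P.[#|K|%:R] = (nb_sols K n)%:R.
Proof.
by move=> /(_ K) /point_count_eq; rewrite point_count_Mbar point_count_horner => <-; rewrite natz.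
Qed.

(** * Derivation of power series *)

Lemma big_ord_widen0 (V : nmodType) n N (H : nat -> V) : (n <= N)%N ->
  (forall m, (n <= m)%N -> H m = 0) -> \sum_(m < n) H m = \sum_(m < N) H m.
Proof.
move=> nN H0; rewrite (big_ord_widen N H nN) [RHS](bigID (fun m : 'I_N => m < n)%N) /=.
by rewrite [X in _ = _ + X]big1 ?addr0 // => m; rewrite -leqNgt; apply: H0.
Qed.

Section Truncation.
Variable R : comNzRingType.
Implicit Types f g : {fps R}.

(** These polynomials compute the coefficients of products below degree N; the Leibniz rule for
    series is inherited through them. *)
Definition truncate N f : {poly R} := \poly_(i < N) f i.

Lemma coef_truncate N f i : (i < N)%N -> (truncate N f)`_i = f i.
Proof. by move=> iN; rewrite coef_poly iN. Qed.

Lemma fps_mul_truncate N f g n : (n < N)%N -> (f * g) n = (truncate N f * truncate N g)`_n.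
Proof.
move=> nN; rewrite coefM fpsME; apply: eq_bigr => i _.
by rewrite !coef_truncate //; have := ltn_ord i; lia.
Qed.

Lemma fpsMnE f k n : (f *+ k) n = f n *+ k.
Proof. by elim: k => [|k IH]; rewrite ?mulr0n // !mulrS fpsDE IH. Qed.

Lemma fps_constME (a : R) f n : (fps_const a * f) n = a * f n.
Proof.
rewrite fpsME big_ord_recl subn0 /= big1 ?addr0 // => i _.
by rewrite mul0r.
Qed.

Lemma fps_constM (a b : R) : fps_const (a * b) = fps_const a * fps_const b.
Proof. by apply: fpsP => -[|n]; rewrite fps_constME //= mulr0. Qed.

Lemma fps_const1 : fps_const 1 = 1 :> {fps R}. Proof. by []. Qed.

Lemma fps_const_is_zmod : zmod_morphism (@fps_const R).
Proof. by move=> a b; apply: fpsP => -[|n]; rewrite fpsDE fpsNE //= subr0. Qed.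
Lemma fps_const_is_monoid : monoid_morphism (@fps_const R).
Proof. by split=> // a b; exact: fps_constM. Qed.
HB.instance Definition _ := GRing.isZmodMorphism.Build R {fps R} (@fps_const R) fps_const_is_zmod.
HB.instance Definition _ := GRing.isMonoidMorphism.Build R {fps R} (@fps_const R) fps_const_is_monoid.

Lemma fps_var_mulE f n : (fps_var * f) n = if n is n'.+1 then f n' else 0.
Proof.
case: n => [|n]; first by rewrite fpsME big_ord1 /= mul0r.
rewrite fpsME big_ord_recl /= mul0r add0r big_ord_recl /= mul1r big1 ?addr0 => [|i _].
  by rewrite /bump subSS subn0.
by rewrite mul0r.
Qed.

Definition fps_deriv f : {fps R} := \fps_(n) (f n.+1 *+ n.+1).

Lemma fps_deriv_is_zmod : zmod_morphism fps_deriv.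
Proof. by move=> f g; apply: fpsP => n; rewrite !(fpsDE, fpsNE) /= mulrnBl. Qed.
HB.instance Definition _ := GRing.isZmodMorphism.Build {fps R} {fps R} fps_deriv fps_deriv_is_zmod.

Lemma coef_deriv_truncate N f i : (i < N)%N -> (truncate N.+1 f)^`()`_i = fps_deriv f i.
Proof. by move=> iN; rewrite coef_deriv coef_truncate. Qed.

Lemma fps_derivM f g : fps_deriv (f * g) = fps_deriv f * g + f * fps_deriv g.
Proof.
apply: fpsP => n; rewrite fpsDE (_ : fps_deriv (f * g) n = (f * g) n.+1 *+ n.+1) //.
rewrite (@fps_mul_truncate n.+2) // -coef_deriv derivM coefD.
rewrite !coefM !fpsME; congr (_ + _); apply: eq_bigr => i _.
  by rewrite coef_deriv_truncate ?coef_truncate //; have := ltn_ord i; lia.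
by rewrite coef_deriv_truncate ?coef_truncate //; have := ltn_ord i; lia.
Qed.

Lemma fps_derivC a : fps_deriv (fps_const a) = 0.
Proof. by apply: fpsP => n; rewrite /= mul0rn. Qed.

Lemma fps_deriv1 : fps_deriv 1 = 0. Proof. exact: fps_derivC. Qed.

Lemma fps_derivCM a f : fps_deriv (fps_const a * f) = fps_const a * fps_deriv f.
Proof. by rewrite fps_derivM fps_derivC mul0r add0r. Qed.

Lemma fps_derivD f g : fps_deriv (f + g) = fps_deriv f + fps_deriv g.
Proof. exact: raddfD. Qed.

Lemma fps_derivB f g : fps_deriv (f - g) = fps_deriv f - fps_deriv g.
Proof. exact: raddfB. Qed.

Lemma fps_derivX : fps_deriv fps_var = 1.
Proof. by apply: fpsP => -[|n] /=; rewrite ?mul0rn. Qed.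

Lemma fps_deriv_exp f n : fps_deriv (f ^+ n.+1) = (f ^+ n * fps_deriv f) *+ n.+1.
Proof.
elim: n => [|n IH]; first by rewrite expr1 expr0 mul1r.
rewrite exprS fps_derivM IH mulrnAr [in RHS]mulrS mulrA -exprS; congr (_ + _).
by rewrite mulrC.
Qed.

Lemma fps_deriv_prod (I : eqType) (r : seq I) (G : I -> {fps R}) : uniq r ->
  fps_deriv (\prod_(y <- r) G y)
  = \sum_(x <- r) \prod_(y <- r) if y == x then fps_deriv (G y) else G y.
Proof.
elim: r => [|x r IH] /=; first by rewrite !big_nil -fps_const1 fps_derivC.
case/andP=> xr ur; rewrite !big_cons fps_derivM IH // eqxx; congr (_ * _ + _).
  apply: eq_big_seq => y yr; case: eqP => // yx; by rewrite -yx yr in xr.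
rewrite mulr_sumr; apply: eq_big_seq => z zr; rewrite big_cons.
by case: eqP => // xz; rewrite xz zr in xr.
Qed.

Lemma iter_deriv0 n f : iter n fps_deriv f 0 = f n *+ n`!.
Proof.
elim: n f => [|n IH] f; first by [].
by rewrite iterSr IH /= -mulrnA factS.
Qed.

(** The iterated Leibniz rule: the word [t] records which factor is differentiated at each of the n
    steps. *)
Lemma iter_deriv_prod (I : finType) n (G : I -> {fps R}) :
  (\prod_y G y) n *+ n`! = \sum_(t : n.-tuple I) \prod_y iter (count_mem y t) fps_deriv (G y) 0.
Proof.
elim: n G => [|n IH] G.
  rewrite (big_pred1 [tuple]) => [|t]; last by apply/esym/eqP; exact: tuple0. 
  rewrite mulr1n /=; elim/big_rec2: _ => // y u v _ <-.
  by rewrite fpsME big_ord1.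
have -> : (\prod_y G y) n.+1 *+ n.+1`! = fps_deriv (\prod_y G y) n *+ n`!.
  by rewrite /= -mulrnA factS.
rewrite fps_deriv_prod ?index_enum_uniq // fps_sumE -sumrMnl.
(* The first letter of a word is split off; it names the factor differentiated first. *)
rewrite (reindex (fun p : I * n.-tuple I => [tuple of p.1 :: p.2])) /=; last first.
  exists (fun t : n.+1.-tuple I => (thead t, [tuple of behead t])) => [[x t] _ | t _] /=.
    by congr (_, _); apply: val_inj.
  by rewrite -tuple_eta.
rewrite -(pair_bigA _ (fun x (t : n.-tuple I) => \prod_y iter ((x == y) + count_mem y t) fps_deriv (G y) 0)) /=.
apply: eq_bigr => x _; rewrite IH; apply: eq_bigr => t _; apply: eq_bigr => y _.
by rewrite addnC iterD eq_sym; case: eqP.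
Qed.

End Truncation.

(** * The differential equation over a finite field *)

Lemma fact_rat_neq0 n : n`!%:R != 0 :> rat.
Proof. by rewrite pnatr_eq0 -lt0n fact_gt0. Qed.

(** To be read with P = e^(q-1), f = e^q and Q = q. The derivative of the power relation is
    multiplied by e and f is eliminated; the factor Q (1 - Q) that remains is cancelled. *)
Lemma ode_algebra (A : comUnitRingType) (P e f e' Q z : A) : Q * (1 - Q) \is a GRing.unit ->
  P * e = f -> P * e' * Q = Q * 1 + Q ^+ 2 * (e' - 1) ->
  f = 1 + Q * z + Q ^+ 2 * (e - 1 - z) -> e' * (1 + Q + Q * z - Q * e) = e.
Proof.
move=> Qu Pe De fE; apply: (mulrI Qu); apply/eqP; rewrite -subr_eq0; apply/eqP.
transitivity (e' * Q * (1 + Q * z + Q ^+ 2 * (e - 1 - z)) - e * (Q * 1 + Q ^+ 2 * (e' - 1))).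
  by ring.
by rewrite -fE -Pe -De; ring.
Qed.

Section PointCountSeries.
Variable K : finFieldType.
Local Notation q := #|K|.

Definition point_series : Qz := \fps_(n) ((nb_sols K n.+1)%:R / n`!%:R).
Local Notation E := point_series.

(** A word of length n over K is a function on the labels, and its letter counts are the sizes of
    the fibres. *)
Lemma point_series_expn_coef n : (E ^+ q) n *+ n`!
  = (\sum_(f : {ffun 'I_n -> K}) \prod_(y : K) nb_sols K #|f @^-1: [set y]|.+1)%N%:R.
Proof.
rewrite -(prodr_const K) iter_deriv_prod natr_sum.
rewrite (reindex (fun f : {ffun 'I_n -> K} => [tuple f i | i < n])) /=; last first.
  exists (fun t : n.-tuple K => [ffun i => tnth t i]) => [f _|t _].
    by apply/ffunP => i; rewrite ffunE tnth_mktuple.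
  by apply: eq_from_tnth => i; rewrite tnth_mktuple ffunE.
apply: eq_bigr => f _; rewrite natr_prod; apply: eq_bigr => y _.
rewrite iter_deriv0 /= -[LHS]mulr_natr divfK ?fact_rat_neq0 //; congr (_ %:R); congr (nb_sols K _.+1).
rewrite count_map -size_filter cardE; apply/perm_size/uniq_perm; rewrite ?enum_uniq //.
  by apply: filter_uniq; exact: enum_uniq.
by move=> i; rewrite mem_filter !mem_enum !inE andbT.
Qed.

Lemma point_series_expn : E ^+ q = 1 + fps_const q%:R * fps_var
  + fps_const q%:R ^+ 2 * (E - 1 - fps_var).
Proof.
apply: fpsP => n; apply: (mulIf (fact_rat_neq0 n)); rewrite mulr_natr point_series_expn_coef.
rewrite -rmorphXn !fpsDE !fps_constME !fpsDE !fpsNE fps1E /=.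
case: (ltnP 1 n) => n1.
  rewrite -nb_sols_rec //; case: n n1 => [|[|n]] //= _.
  by rewrite mulr0 !subr0 !add0r mulrA divfK ?fact_rat_neq0 // natrM natrX.
rewrite (eq_bigr (fun=> 1%N)) => [|f _]; last first.
  rewrite big1 // => y _; apply: card_sols_le3.
  by rewrite ltnS (leq_trans (max_card _)) // card_ord (leq_trans n1).
rewrite sum1_card card_ffun card_ord; case: n n1 => [|[|//]] _ /=.
  by rewrite expn0 card_sols_le3 // divr1 !subr0 subrr !mulr0 !addr0.
by rewrite expn1 card_sols_le3 // divr1 subr0 subrr mulr0 addr0 add0r ?mulr1.
Qed.

Lemma point_series_ode :
  fps_deriv E * (1 + fps_const q%:R + fps_const q%:R * fps_var - fps_const q%:R * E) = E.
Proof.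
have q1 : (1 < q)%N by exact: card_finRing_gt1.
have [q0 q10] : q%:R != 0 :> rat /\ 1 - q%:R != 0 :> rat.
  by rewrite pnatr_eq0 -lt0n (ltnW q1) subr_eq0 eq_sym pnatr_eq1; split=> //; rewrite neq_ltn q1 orbT.
have Eq : E ^+ q.-1 * E = E ^+ q by rewrite -exprSr prednK // ltnW.
have := congr1 (@fps_deriv _) point_series_expn.
rewrite -{1}(prednK (ltnW q1)) fps_deriv_exp (prednK (ltnW q1)) -rmorphXn.
rewrite !(fps_derivB, fps_derivD, fps_derivCM, fps_deriv1, fps_derivX) rmorphXn subr0 add0r.
rewrite -mulr_natr -(rmorph_nat (@fps_const rat)) => D.
apply: (ode_algebra _ Eq D point_series_expn).
by rewrite -fps_const1 -rmorphB -rmorphM fps_unitE /= unitfE mulf_neq0.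
Qed.

End PointCountSeries.

(** * The differential equation in the class of the affine line *)

Lemma exists_primes n : exists s : seq nat, [/\ uniq s, all prime s & size s = n].
Proof.
elim: n => [|n [s [us ps sn]]]; first by exists [::].
have [p sp pp] := prime_above (\max_(x <- s) x).
exists (p :: s); rewrite /= pp ps us sn andbT; split=> //.
apply: contraL sp => sp; rewrite -leqNgt.
exact: (@leq_bigmax_seq _ s xpredT id p sp isT).
Qed.

Lemma poly_eq_primes (p r : {poly rat}) :
  (forall q, prime q -> p.[q%:R] = r.[q%:R]) -> p = r.
Proof.
move=> pr; apply/eqP; rewrite -subr_eq0; apply/negPn/negP => nz.
have [s [us ps sn]] := exists_primes (size (p - r)).
have := @max_poly_roots _ (p - r) [seq x%:R | x <- s] nz.
rewrite size_map sn ltnn => H; suff : false by []; apply: H.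
  apply/allP => _ /mapP [q /(allP ps) qp ->].
  by rewrite rootE hornerD hornerN pr // subrr.
by rewrite map_inj_uniq // => x y /eqP; rewrite eqr_nat => /eqP.
Qed.

Section MapFps.
Variables (R S : comNzRingType) (phi : {rmorphism R -> S}).

Definition fps_map (f : {fps R}) : {fps S} := \fps_(n) phi (f n).

Lemma fps_map_is_zmod : zmod_morphism fps_map.
Proof. by move=> f g; apply: fpsP => n; rewrite !(fpsDE, fpsNE) /= rmorphB. Qed.
Lemma fps_map_is_monoid : monoid_morphism fps_map.
Proof.
split=> [|f g]; apply: fpsP => n; first by case: n => [|n]; rewrite fps1E /= ?rmorph1 ?rmorph0.
by rewrite /= rmorph_sum; apply: eq_bigr => i _; rewrite rmorphM.
Qed.
HB.instance Definition _ := GRing.isZmodMorphism.Build {fps R} {fps S} fps_map fps_map_is_zmod.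
HB.instance Definition _ := GRing.isMonoidMorphism.Build {fps R} {fps S} fps_map fps_map_is_monoid.

Lemma fps_map_var : fps_map fps_var = fps_var.
Proof. by apply: fpsP => n; rewrite /= rmorph_nat. Qed.

Lemma fps_map_const c : fps_map (fps_const c) = fps_const (phi c).
Proof. by apply: fpsP => -[|n] //=; rewrite rmorph0. Qed.

Lemma fps_map_deriv f : fps_map (fps_deriv f) = fps_deriv (fps_map f).
Proof. by apply: fpsP => n; rewrite /= rmorphMn. Qed.

End MapFps.

Section SwapFps.
Variable R : comNzRingType.

(** Series in z over polynomials in L are read as series in L over series in z. *)
Definition fps_swap (f : {fps {poly R}}) : {fps {fps R}} := \fps_(k) \fps_(n) (f n)`_k.

Lemma fps_swapB f g : fps_swap (f - g) = fps_swap f - fps_swap g.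
Proof. by apply: fpsP => k; apply: fpsP => n; exact: coefB. Qed.

Lemma fps_swapD f g : fps_swap (f + g) = fps_swap f + fps_swap g.
Proof. by apply: fpsP => k; apply: fpsP => n; exact: coefD. Qed.

Lemma fps_swapM f g : fps_swap (f * g) = fps_swap f * fps_swap g.
Proof.
apply: fpsP => k; apply: fpsP => n; rewrite fpsME fps_sumE /= coef_sum.
rewrite (eq_bigr (fun i : 'I_n.+1 => \sum_(j < k.+1) (f i)`_j * (g (n - i)%N)`_(k - j)%N)).
  by rewrite exchange_big.
by move=> i _; rewrite coefM.
Qed.

Lemma fps_swap1 : fps_swap 1 = 1.
Proof.
by apply: fpsP => k; apply: fpsP => n; case: k => [|k]; case: n => [|n]; rewrite /= ?coef1 ?coef0.
Qed.

Lemma fps_swapX : fps_swap (fps_const 'X) = fps_var.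
Proof.
apply: fpsP => k; apply: fpsP => -[|n] /=; first by rewrite coefX; case: (k == 1%N).
by rewrite coef0; case: (k == 1%N).
Qed.

Lemma fps_swap_var : fps_swap fps_var = fps_const fps_var.
Proof.
apply: fpsP => k; apply: fpsP => n /=.
by case: k => [|k] /=; case: (n == 1%N); rewrite /= ?coef1 ?coef0.
Qed.


End SwapFps.

Section MbarSeries.
Variable M : nat -> {poly int}.
Hypothesis HM : forall n, (3 <= n)%N -> is_Mbar_class_poly n (M n).

(** Coefficient n belongs to n + 1 marked points; the two values 1 below the stable range give the
    summand 1 + z. *)
Definition Mbar_series : {fps {poly rat}} :=
  \fps_(n) (if (n < 2)%N then 1 else n`!%:R^-1 *: map_poly intr (M n.+1)).

Lemma Mbar_series_eval (K : finFieldType) :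
  fps_map (horner_eval (#|K|%:R : rat)) Mbar_series = point_series K.
Proof.
apply: fpsP => n /=; rewrite /horner_eval; case: ltnP => n2.
  rewrite card_sols_le3 //; last by rewrite (leq_trans n2).
  by rewrite hornerC; case: n n2 => [|[|]].
rewrite hornerZ mulrC; congr (_ / _).
have -> : (#|K|%:R : rat) = (#|K|%:R : int)%:~R by rewrite rmorph_nat.
by rewrite horner_map (Mbar_class_poly_count K (HM _)) //= rmorph_nat.
Qed.

(** Coefficientwise this is an identity of polynomials in L; it holds at every prime q by counting
    over ['F_q], hence identically. *)
Lemma Mbar_series_ode : fps_deriv Mbar_series *
  (1 + fps_const 'X + fps_const 'X * fps_var - fps_const 'X * Mbar_series) = Mbar_series.
Proof.
apply: fpsP => n; apply: poly_eq_primes => q qp.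
have cq : #|'F_q| = q by apply: card_Fp.
have := point_series_ode 'F_q; rewrite -Mbar_series_eval.
set ev := horner_eval _; rewrite -fps_map_deriv.
have -> : fps_const #|'F_q|%:R = fps_map ev (fps_const 'X).
  by rewrite fps_map_const /= /horner_eval hornerX.
rewrite -(fps_map_var ev) -(rmorph1 (fps_map ev)).
rewrite -!rmorphM -!rmorphD -rmorphB -rmorphM => /(congr1 (fun f : {fps rat} => f n)).
by rewrite /= /horner_eval cq.
Qed.

Definition map_deriv (R : comNzRingType) (f : {fps {fps R}}) : {fps {fps R}} :=
  \fps_(k) fps_deriv (f k).

Lemma fps_swap_deriv (R : comNzRingType) (f : {fps {poly R}}) :
  fps_swap (fps_deriv f) = map_deriv (fps_swap f).
Proof. by apply: fpsP => k; apply: fpsP => n; rewrite /= coefMn. Qed.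

Lemma Mhat_swap : Mhat M = fps_swap Mbar_series.
Proof.
apply: fpsP => k; apply: fpsP => n; rewrite fpsDE /= !ltnS.
have [n2|n2] := leqP n 1.
  rewrite addr0; case: k => [|k]; last by rewrite coef1.
  by rewrite fpsDE fps1E coef1; case: n n2 => [|[|]].
rewrite coefZ coef_map mulrC; case: k => [|k] /=; last by rewrite add0r.
by case: n n2 => [|[|n]] //= _; rewrite !add0r.
Qed.

Lemma Mhat_ode : map_deriv (Mhat M) *
  (1 + fps_var + fps_var * fps_const fps_var - fps_var * Mhat M) = Mhat M.
Proof.
rewrite Mhat_swap -fps_swap_deriv -[in RHS]Mbar_series_ode fps_swapM fps_swapB !fps_swapD.
by rewrite !fps_swapM fps_swap1 fps_swapX fps_swap_var.
Qed.

End MbarSeries.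

(** * The tree function *)

(** The coefficient of degree n + 1 of a solution, multiplied by n + 1, is determined by those up to
    degree n. *)
Lemma fps_ode_uniq (h f g : Qz) : fps_deriv f = h * f -> fps_deriv g = h * g ->
  f 0 = g 0 -> f = g.
Proof.
move=> Df Dg fg0; apply: fpsP => n.
suff : forall m, (m <= n)%N -> f m = g m by apply.
elim: n => [|n IH] m; first by rewrite leqn0 => /eqP ->.
rewrite leq_eqVlt => /orP[/eqP ->|/IH //].
have : f n.+1 *+ n.+1 = g n.+1 *+ n.+1.
  have /(congr1 (fun u : Qz => u n)) /= -> := Df.
  have /(congr1 (fun u : Qz => u n)) /= -> := Dg.
  by apply: eq_bigr => i _; rewrite IH // leq_subr.
by move/eqP; rewrite -subr_eq0 -mulrnBl mulrn_eq0 subr_eq0 => /eqP.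
Qed.

Lemma exp_fps_deriv a : fps_deriv (exp_fps a) = fps_const a * exp_fps a.
Proof.
apply: fpsP => n; rewrite fps_constME /= -[LHS]mulr_natr factS natrM exprS.
by field; rewrite fact_rat_neq0 nat1r pnatr_eq0.
Qed.

Lemma exp_fpsD a b : exp_fps (a + b) = exp_fps a * exp_fps b.
Proof.
apply: (@fps_ode_uniq (fps_const (a + b))); first exact: exp_fps_deriv.
  by rewrite fps_derivM !exp_fps_deriv rmorphD /=; ring.
by rewrite fpsME big_ord1 /= !divr1 ?mulr1.
Qed.

Lemma exp_fps0 : exp_fps 0 = 1.
Proof. by apply: fpsP => n; rewrite fps1E /= expr0n; case: n => //= n; rewrite mul0r. Qed.

Lemma exp_fps_nat n : exp_fps n%:R = exp_fps 1 ^+ n.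
Proof. by elim: n => [|n IH]; rewrite ?exp_fps0 // -natr1 exp_fpsD IH exprSr. Qed.

Section Composition.
Variable R : comNzRingType.
Implicit Types f g : {fps R}.

Lemma fps_compE f g n N : g 0 = 0 -> (n < N)%N -> fps_comp f g n = \sum_(m < N) f m * (g ^+ m) n.
Proof.
move=> g0 nN; transitivity (\sum_(m < n.+1) f m * (g ^+ m) n).
  by apply: eq_bigr => m _; exact: fps_constME.
by apply: (big_ord_widen0 (H := fun m => f m * (g ^+ m) n)) => // m nm; rewrite fps_exp_small ?mulr0.
Qed.

Lemma fps_comp_deriv f g : g 0 = 0 ->
  fps_deriv (fps_comp f g) = fps_deriv g * fps_comp (fps_deriv f) g.
Proof.
move=> g0; apply: fpsP => n; rewrite mulrC.
have -> : fps_deriv (fps_comp f g) n = fps_comp f g n.+1 *+ n.+1 by [].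
rewrite (fps_compE f g0 (ltnSn _)) big_ord_recl expr0 fps1E mulr0 add0r -sumrMnl.
transitivity (\sum_(m < n.+1) \sum_(i < n.+1) fps_deriv f m * ((g ^+ m) i * fps_deriv g (n - i)%N)).
  apply: eq_bigr => m _; rewrite -mulr_sumr -fpsME -mulrnAr.
  have -> : (g ^+ fintype.lift ord0 m) n.+1 *+ n.+1 = fps_deriv (g ^+ m.+1) n by [].
  by rewrite fps_deriv_exp fpsMnE mulrnAr mulrnAl.
rewrite exchange_big fpsME; apply: eq_bigr => i _.
rewrite (fps_compE _ g0 (ltn_ord i)) mulr_suml; apply: eq_bigr => m _.
by rewrite mulrA.
Qed.
End Composition.

(* The coefficient of z^(n-1) in e^z (e^z - 1)^n, a series of order n. *)
Lemma finite_difference n : (0 < n)%N ->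
  \sum_(j < n.+1) (-1) ^+ (n - j) * ((j.+1%:R : rat) ^+ n.-1) *+ 'C(n, j) = 0.
Proof.
move=> n0; have e0 : (exp_fps 1 - 1) 0 = 0 by rewrite fpsDE fpsNE fps1E /= divr1 expr0 subrr.
have : (exp_fps 1 * (exp_fps 1 - 1) ^+ n) n.-1 = 0.
  rewrite fpsME big1 // => i _; rewrite (fps_exp_small e0) ?mulr0 //; lia.
rewrite addrC exprDn mulr_sumr fps_sumE => E.
apply: (mulIf (invr_neq0 (fact_rat_neq0 n.-1))); rewrite mul0r -[RHS]E mulr_suml.
apply: eq_bigr => j _; rewrite -exp_fps_nat.
have -> : exp_fps 1 * ((-1) ^+ (n - j) * exp_fps j%:R *+ 'C(n, j))
    = (fps_const ((-1) ^+ (n - j)) * exp_fps j.+1%:R) *+ 'C(n, j).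
  by rewrite mulrnAr mulrCA -exp_fpsD nat1r rmorphXn rmorphN1.
by rewrite fpsMnE fps_constME /= mulrA mulrnAl.
Qed.

Lemma poly_eq_deriv (p r : {poly rat}) a : p^`() = r^`() -> p.[a] = r.[a] -> p = r.
Proof.
move=> dpr pra; apply/eqP; rewrite -subr_eq0; apply/eqP.
have [c pc] : exists c, p - r = c%:P.
  exists (p - r)`_0; apply/polyP => -[|n]; rewrite coefC //=.
  have : (p - r)^`()`_n = 0 by rewrite derivB dpr subrr coef0.
  by rewrite coef_deriv => /eqP; rewrite mulrn_eq0 => /eqP.
by rewrite pc -[c in LHS](hornerC c a) -pc hornerD hornerN pra subrr.
Qed.

(* Both sides have the same derivative by induction; at [-(n + 1)] the left-hand side is a finite
   difference. *)
Lemma abel_identity n :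
  \sum_(j < n.+1) (j.+1%:R ^+ j.-1 *: ('X + ((n - j)%:R : rat)%:P) ^+ (n - j)) *+ 'C(n, j)
  = ('X + n.+1%:R%:P) ^+ n.
Proof.
elim: n => [|n IH]; first by rewrite big_ord1 /= !expr0 scale1r.
apply: (@poly_eq_deriv _ _ (- n.+2%:R)).
  rewrite deriv_exp derivD derivX derivC addr0 mul1r /=.
  (* The derivative of either side is n + 1 times the same side of the identity for n, with X + 1 in
     place of X. *)
  have := congr1 (fun p : {poly rat} => p \Po ('X + 1)) IH.
  have compE m k : ('X + (k%:R : rat)%:P) ^+ m \Po ('X + 1) = ('X + (k.+1%:R : rat)%:P) ^+ m.
    by rewrite rmorphXn /= comp_polyD comp_polyX comp_polyC -natr1 polyCD [k%:R%:P + _]addrC addrA.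
  rewrite compE => <-; rewrite raddf_sum big_ord_recr /= subnn expr0.
  rewrite derivMn derivZ derivC scaler0 mul0rn addr0 [in RHS]raddf_sum -sumrMnl /=.
  apply: eq_bigr => j _; have jn : (j <= n)%N by rewrite -ltnS.
  rewrite derivMn derivZ deriv_exp derivD derivX derivC addr0 mul1r -scalerMnr.
  rewrite [in RHS](raddfMn (comp_poly _)) /= comp_polyZ compE subSn // /= -!mulrnA; congr (_ *: _ *+ _).
  by rewrite -subSn // [RHS]mulnC (mul_bin_down n.+1 j).
rewrite horner_exp hornerD hornerX hornerC addNr expr0n /= horner_sum -[RHS](finite_difference (ltn0Sn n)).
apply: eq_bigr => j _; have jn : (j <= n.+1)%N by rewrite -ltnS.
rewrite hornerMn hornerZ horner_exp hornerD hornerX hornerC; congr (_ *+ _).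
have -> : - n.+2%:R + (n.+1 - j)%:R = - (j.+1%:R : rat).
  by rewrite natrB // -(natr1 n.+1) -(natr1 j); ring.
rewrite [in LHS]exprNn mulrCA -exprD; congr (_ * _).
case: (nat_of_ord j) jn => [|k] kn; first by rewrite !expr1n.
by congr (_ ^+ _); rewrite /=; lia.
Qed.

(** For m = 0 the predecessor gives the exponent 0 instead of -1, which is harmless as the base is
    1. *)
Lemma tree_fpsS m : tree_fps m.+1 = m.+1%:R ^+ m.-1 / m`!%:R.
Proof.
rewrite /= factS natrM invfM natrX mulrA; congr (_ / _).
case: m => [|m]; first by rewrite !expr0 mul1r invr1.
by rewrite exprSr mulfK // pnatr_eq0.
Qed.

(** Abel's identity at X = 1, divided by n!. *)
Lemma tree_deriv : fps_deriv (fps_divX tree_fps) = fps_deriv tree_fps * fps_divX tree_fps.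
Proof.
apply: fpsP => n; rewrite mulrC fpsME.
have dtree i : fps_deriv tree_fps i = i.+1%:R ^+ i / i`!%:R.
  by rewrite -[LHS]mulr_natr /= factS natrM natrX; field; rewrite fact_rat_neq0 nat1r pnatr_eq0.
have := congr1 (fun p : {poly rat} => p.[1]) (abel_identity n).
rewrite horner_sum horner_exp hornerD hornerX hornerC nat1r => abel.
transitivity ((n.+2%:R : rat) ^+ n / n`!%:R).
  have -> : fps_deriv (fps_divX tree_fps) n = tree_fps n.+2 *+ n.+1 by [].
  rewrite tree_fpsS factS natrM -[LHS]mulr_natr.
  by field; rewrite fact_rat_neq0 nat1r pnatr_eq0.
rewrite -abel mulr_suml; apply: eq_bigr => j _.
have jn : (j <= n)%N by rewrite -ltnS.
have -> : fps_divX tree_fps j = tree_fps j.+1 by [].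
rewrite dtree tree_fpsS hornerMn hornerZ horner_exp hornerD hornerX hornerC nat1r.
rewrite -(mulr_natr _ 'C(n, j)) -(bin_fact jn) !natrM; field.
by rewrite !fact_rat_neq0 pnatr_eq0 -lt0n bin_gt0 jn.
Qed.

(** Both series solve y' = T' y with y(0) = 1. *)
Lemma exp_tree : fps_comp (exp_fps 1) tree_fps = fps_divX tree_fps.
Proof.
apply: (fps_ode_uniq (h := fps_deriv tree_fps)); last 2 first.
- exact: tree_deriv.
- by rewrite (fps_compE _ (erefl : tree_fps 0 = 0) (ltnSn 0)) big_ord1 expr0 fps1E mulr1 /= ?divr1 ?expr0.
by rewrite fps_comp_deriv // exp_fps_deriv rmorph1 mul1r.
Qed.

(** * Exponential polynomials *)

Lemma poly_fps_is_zmod : zmod_morphism poly_fps.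
Proof. by move=> p r; apply: fpsP => n; exact: coefB. Qed.
Lemma poly_fps_is_monoid : monoid_morphism poly_fps.
Proof.
split=> [|p r]; apply: fpsP => n; first by rewrite fps1E /= coef1.
exact: coefM.
Qed.
HB.instance Definition _ := GRing.isZmodMorphism.Build {poly rat} Qz poly_fps poly_fps_is_zmod.
HB.instance Definition _ := GRing.isMonoidMorphism.Build {poly rat} Qz poly_fps poly_fps_is_monoid.

Lemma poly_fps_deriv p : fps_deriv (poly_fps p) = poly_fps p^`().
Proof. by apply: fpsP => n; rewrite /= coef_deriv. Qed.

Lemma poly_fpsC c : poly_fps c%:P = fps_const c.
Proof. by apply: fpsP => -[|n]; rewrite /= coefC. Qed.

Lemma poly_fpsX : poly_fps 'X = fps_var.
Proof. by apply: fpsP => n; rewrite /= coefX. Qed.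

Lemma poly_deriv_eigen (p : {poly rat}) c : c != 0 -> p^`() = c *: p -> p = 0.
Proof.
move=> c0 dp; apply/eqP; rewrite -lead_coef_eq0 lead_coefE.
have : p^`()`_(size p).-1 = 0.
  by rewrite coef_deriv nth_default ?mul0rn ?leqSpred.
by rewrite dp coefZ => /eqP; rewrite mulf_eq0 (negbTE c0).
Qed.

Lemma poly_deriv_eq0 (p : {poly rat}) : p^`() = 0 -> p = (p`_0)%:P.
Proof.
move=> dp; apply: (@poly_eq_deriv _ _ 0); first by rewrite dp derivC.
by rewrite hornerC horner_coef0.
Qed.

Section ExponentialPolynomials.
Implicit Types a b : {poly {poly rat}}.
Local Notation e := (exp_fps 1).

(* [\sum_j a_j(z) e^(j z)]. *)
Definition exp_poly a : Qz := (map_poly poly_fps a).[e].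

Lemma exp_poly_is_zmod : zmod_morphism exp_poly.
Proof. by move=> a b; rewrite /exp_poly rmorphB hornerD hornerN. Qed.
Lemma exp_poly_is_monoid : monoid_morphism exp_poly.
Proof.
split=> [|a b]; first by rewrite /exp_poly rmorph1 hornerC.
by rewrite /exp_poly rmorphM hornerM.
Qed.
HB.instance Definition _ := GRing.isZmodMorphism.Build {poly {poly rat}} Qz exp_poly exp_poly_is_zmod.
HB.instance Definition _ := GRing.isMonoidMorphism.Build {poly {poly rat}} Qz exp_poly exp_poly_is_monoid.

Lemma exp_polyC (c : {poly rat}) : exp_poly c%:P = poly_fps c.
Proof. by rewrite /exp_poly map_polyC hornerC. Qed.

Lemma exp_polyX : exp_poly 'X = e.
Proof. by rewrite /exp_poly map_polyX hornerX. Qed.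

Lemma exp_polyE N a : (size a <= N)%N -> exp_poly a = \sum_(j < N) poly_fps a`_j * e ^+ j.
Proof.
move=> aN; rewrite /exp_poly (@horner_coef_wide _ N); last first.
  by apply: leq_trans aN; apply: size_poly.
by apply: eq_bigr => j _; rewrite coef_map.
Qed.

(** The counterpart of d/dz on the coefficients of an exponential polynomial. *)
Definition delta a : {poly {poly rat}} := \poly_(j < size a) ((a`_j)^`() + a`_j *+ j).

Lemma coef_delta a j : (delta a)`_j = (a`_j)^`() + a`_j *+ j.
Proof.
rewrite coef_poly; case: ltnP => // aj.
by rewrite nth_default // linear0 mul0rn addr0.
Qed.

Lemma exp_deriv_expn j : fps_deriv (e ^+ j) = e ^+ j *+ j.
Proof. by rewrite -exp_fps_nat exp_fps_deriv rmorph_nat mulr_natl. Qed.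

Lemma exp_poly_delta a : fps_deriv (exp_poly a) = exp_poly (delta a).
Proof.
rewrite (exp_polyE (leqnn _)) (@exp_polyE (size a) (delta a)) ?size_poly //.
rewrite raddf_sum; apply: eq_bigr => j _; rewrite coef_delta /= fps_derivM poly_fps_deriv.
by rewrite exp_deriv_expn rmorphD rmorphMn /= mulrDl mulrnAl mulrnAr.
Qed.

(** Induction on the number of exponentials and, within it, on the size of the coefficient of the
    highest one, which d/dz - N lowers. *)
Lemma exp_poly_inj a : exp_poly a = 0 -> a = 0.
Proof.
have [N aN] : exists N, (size a <= N)%N by exists (size a).
elim: N a aN => [|N IH] a; first by rewrite leqn0 size_poly_eq0 => /eqP.
move=> aN; have [s] : exists s, (size (a`_N)%R <= s)%N by exists (size a`_N).
elim: s a aN => [|s IHs] a aN.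
  rewrite leqn0 size_poly_eq0 => /eqP aN0; apply: IH.
  apply/leq_sizeP => j; rewrite leq_eqVlt => /orP[/eqP <- //|]; by move/leq_sizeP: aN; apply.
move=> as1 ea; pose b := delta a - a *+ N.
have bE j : b`_j = (a`_j)^`() + a`_j *+ j - a`_j *+ N by rewrite coefB coef_delta coefMn.
have b0 : b = 0.
  apply: IHs.
  - by apply/leq_sizeP => j /(leq_sizeP _ _ aN) aj; rewrite bE aj linear0 !mul0rn subr0 addr0.
  - rewrite bE addrK; have [->|nz] := eqVneq a`_N 0; first by rewrite linear0 size_poly0.
    by rewrite -ltnS (leq_trans (lt_size_deriv nz)).
  - by rewrite raddfB raddfMn /= -exp_poly_delta ea raddf0 mul0rn subr0.
(* From b = 0: each lower coefficient satisfies a_j' = (N - j) a_j and vanishes for degree reasons;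
   the highest one is constant, and the value at z = 0 shows that it is 0. *)
have lowj j : (j < N)%N -> a`_j = 0.
  move=> jN; apply: (@poly_deriv_eigen _ ((N - j)%:R : rat)).
    by rewrite pnatr_eq0 subn_eq0 -ltnNge.
  move: (bE j); rewrite b0 coef0 => /esym/eqP; rewrite subr_eq0 => /eqP E.
  by apply: (addIr (a`_j *+ j)); rewrite E scaler_nat -mulrnDr subnK // ltnW.
have topd : (a`_N)^`() = 0 by move: (bE N); rewrite b0 coef0 addrK.
have aE : a = (a`_N)%:P * 'X^N.
  apply/polyP => j; rewrite coefCM coefXn; case: (ltngtP j N) => [jN|jN|->].
  - by rewrite lowj // mulr0.
  - by rewrite mulr0; move/leq_sizeP: aN; apply.
  - by rewrite mulr1.
have eaE : exp_poly a = poly_fps a`_N * exp_fps N%:R.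
  by rewrite {1}aE rmorphM rmorphXn /= exp_polyC exp_polyX -exp_fps_nat.
have : exp_poly a 0 = (a`_N)`_0.
  by rewrite eaE fpsME big_ord1 /= expr0 divr1 ?mulr1.
rewrite ea => /esym a00; rewrite aE (poly_deriv_eq0 topd) a00 /=.
by rewrite !polyC0 mul0r.
Qed.

End ExponentialPolynomials.

(** * The leading exponential term *)

Lemma coefM_top (R : nzRingType) (p q : {poly R}) m n :
  (size p <= m.+1)%N -> (size q <= n.+1)%N -> (p * q)`_(m + n) = p`_m * q`_n.
Proof.
move=> /leq_sizeP pm /leq_sizeP qn; rewrite coefM.
have mlt : (m < (m + n).+1)%N by rewrite ltnS leq_addr.
rewrite (bigD1 (Ordinal mlt)) //= addKn big1 ?addr0 // => i ne.
have [im|mi] := ltnP m i; first by rewrite pm ?mul0r.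
have im : (i < m)%N by rewrite ltn_neqAle mi andbT.
by rewrite qn ?mulr0 //; lia.
Qed.

Section LeadingTerm.
Variables (M : nat -> {poly int}) (p : nat -> nat -> {poly rat}).
Hypothesis HM : forall n, (3 <= n)%N -> is_Mbar_class_poly n (M n).
Hypothesis Hp : forall k : nat,
  exp_fps 1 * \sum_(m < k.+1) (-1) ^+ m * poly_fps (p k m) * exp_fps (k - m)%N%:R
  = if k == 0%N then 1 + fps_var + alpha M 0 else alpha M k.

Lemma Mhat_coef k : Mhat M k
  = exp_fps 1 * \sum_(m < k.+1) (-1) ^+ m * poly_fps (p k m) * exp_fps (k - m)%N%:R.
Proof.
by rewrite Hp; case: k => [|k]; apply: fpsP => n; [|exact: add0r].
Qed.

(** The coefficient of L^k in [Mhat] as a polynomial in e^z; the prefactor e^z raises the exponents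
    by 1. *)
Definition exp_row k : {poly {poly rat}} :=
  \sum_(m < k.+1) ((-1) ^+ m * p k m)%:P * 'X^((k - m).+1).

Lemma exp_poly_row k : exp_poly (exp_row k) = Mhat M k.
Proof.
rewrite Mhat_coef raddf_sum mulr_sumr; apply: eq_bigr => m _ /=.
rewrite rmorphM rmorphXn /= exp_polyC exp_polyX exp_fps_nat exprS rmorphM rmorphXn rmorphN1.
by ring.
Qed.

Lemma coef_exp_row k j : (exp_row k)`_j
  = \sum_(m < k.+1) ((-1) ^+ m * p k m) * (j == (k - m).+1)%:R.
Proof. by rewrite coef_sum; apply: eq_bigr => m _; rewrite coefCM coefXn. Qed.

Lemma size_exp_row k : (size (exp_row k) <= k.+2)%N.
Proof.
apply/leq_sizeP => j kj; rewrite coef_exp_row big1 // => m _.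
by case: eqP => [jE|_]; rewrite ?mulr0 //; lia.
Qed.

Lemma exp_row_top k : (exp_row k)`_k.+1 = p k 0.
Proof.
rewrite coef_exp_row big_ord_recl subn0 eqxx expr0 mul1r mulr1 big1 ?addr0 // => m _.
rewrite (_ : (_ == _) = false) ?mulr0 //; apply/negbTE/eqP; rewrite /= /bump.
by have := ltn_ord m; lia.
Qed.

Lemma size_delta_exp_row k : (size (delta (exp_row k)) <= k.+2)%N.
Proof. by apply: leq_trans (size_exp_row k); exact: size_poly. Qed.

Lemma Mhat_ode0 : fps_deriv (Mhat M 0) = Mhat M 0.
Proof.
have /(congr1 (fun f : Qzt => f 0%N)) := Mhat_ode HM.
rewrite fpsME big_ord1 !fpsDE fpsNE fps1E !fps_var_mulE /=.
by rewrite subr0 !addr0 mulr1.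
Qed.

Lemma Mhat_odeS k : fps_deriv (Mhat M k.+1) + fps_deriv (Mhat M k) * (1 + fps_var)
  - \sum_(i < k.+1) fps_deriv (Mhat M i) * Mhat M (k - i)%N = Mhat M k.+1.
Proof.
have := Mhat_ode HM; set D := map_deriv _ => ode.
have {}ode : D + fps_var * (D * fps_const (1 + fps_var) - D * Mhat M) = Mhat M.
  by rewrite -[RHS]ode rmorphD rmorph1 /=; ring.
have /(congr1 (fun f : Qzt => f k.+1)) := ode.
rewrite fpsDE fps_var_mulE fpsDE fpsNE [D * fps_const _]mulrC fps_constME fpsME => E.
by rewrite -[RHS]E -addrA [fps_deriv (Mhat M k) * _]mulrC.
Qed.

(** The coefficient of e^((k+2)z) in [Mhat_odeS]. In the products only the leading terms contribute,
    and the summand with 1 + z reaches only e^((k+1)z). *)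
Lemma exp_row_rec k :
  (p k.+1 0)^`() + p k.+1 0 *+ k.+1
  = \sum_(i < k.+1) ((p i 0)^`() + p i 0 *+ i.+1) * p (k - i)%N 0.
Proof.
have E : exp_poly (delta (exp_row k.+1) + delta (exp_row k) * (1 + 'X)%:P
   - \sum_(i < k.+1) delta (exp_row i) * exp_row (k - i)%N - exp_row k.+1) = 0.
  have eB a b : exp_poly (a - b) = exp_poly a - exp_poly b by exact: rmorphB.
  have eD a b : exp_poly (a + b) = exp_poly a + exp_poly b by exact: rmorphD.
  have eM a b : exp_poly (a * b) = exp_poly a * exp_poly b by exact: rmorphM.
  rewrite !eB eD eM exp_polyC rmorph_sum /= -!exp_poly_delta !exp_poly_row.
  rewrite rmorphD rmorph1 /= poly_fpsX.
  rewrite (eq_bigr (fun i : 'I_k.+1 => fps_deriv (Mhat M i) * Mhat M (k - i)%N)).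
    by rewrite Mhat_odeS subrr.
  by move=> i _; rewrite eM -exp_poly_delta !exp_poly_row.
have := congr1 (fun a : {poly {poly rat}} => a`_k.+2) (exp_poly_inj E).
rewrite !(coefB, coefD) coefMC coef0 coef_sum coef_delta exp_row_top.
rewrite [(delta _)`_k.+2]nth_default ?size_delta_exp_row // mul0r addr0.
rewrite (eq_bigr (fun i : 'I_k.+1 => ((p i 0)^`() + p i 0 *+ i.+1) * p (k - i)%N 0)).
  move/eqP; rewrite subr_eq0 subr_eq => /eqP; rewrite mulrSr addrA addrC => /addrI ->.
  by [].
move=> i _; have ik : (i <= k)%N by rewrite -ltnS.
have -> : k.+2 = (i.+1 + (k - i).+1)%N by rewrite addSn addnS subnKC.
by rewrite coefM_top ?size_delta_exp_row ?size_exp_row // coef_delta !exp_row_top.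
Qed.

Lemma leading_coef k : p k 0 = (tree_fps k.+1)%:P.
Proof.
elim/ltn_ind: k => -[|k] IH.
  (* For k = 0 the equation for the coefficient of L^0 makes the polynomial constant, and the value
     at z = 0 fixes it. *)
  have E : exp_poly (delta (exp_row 0) - exp_row 0) = 0.
    by rewrite raddfB /= -exp_poly_delta !exp_poly_row Mhat_ode0 subrr.
  have := congr1 (fun a : {poly {poly rat}} => a`_1) (exp_poly_inj E).
  rewrite coefB coef_delta exp_row_top mulr1n addrK coef0 => /poly_deriv_eq0 ->.
  have m0 : Mhat M 0%N 0%N = 1 by rewrite -[RHS]addr0 -[X in _ = X + _]addr0.
  have := congr1 (fun f : Qz => f 0%N) (Mhat_coef 0); rewrite m0.
  by rewrite big_ord1 expr0 mul1r exp_fps0 mulr1 fpsME big_ord1 /= expr0 divr1 mul1r => <-.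
have tr : (tree_fps k.+2 *+ k.+1 : rat)
    = \sum_(i < k.+1) (tree_fps i.+1 *+ i.+1) * tree_fps (k - i).+1.
  exact: (congr1 (fun f : Qz => f k) tree_deriv).
have rec := exp_row_rec k; apply/eqP; rewrite -subr_eq0; apply/eqP.
(* The difference d of the two sides satisfies d' = -(k + 1) d. *)
apply: (@poly_deriv_eigen _ (- k.+1%:R)); first by rewrite oppr_eq0 pnatr_eq0.
apply/eqP; rewrite derivB derivC subr0 scaleNr scaler_nat -addr_eq0 mulrnBl addrA rec.
rewrite -polyCMn tr rmorph_sum subr_eq0 /=; apply/eqP; apply: eq_bigr => i _.
by rewrite !IH ?ltn_ord ?ltnS ?leq_subr // derivC add0r -polyCMn -polyCM.
Qed.

End LeadingTerm.

(** * Substitution of the scaled variable *)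

Section Scaling.
Variable R : comNzRingType.

Lemma fps_var_expE m n : ((fps_var : {fps R}) ^+ m) n = (n == m)%:R.
Proof.
elim: m n => [|m IH] n; first by rewrite expr0 fps1E.
by rewrite exprS fps_var_mulE; case: n => [|n] //; rewrite IH eqSS.
Qed.

Lemma fps_mul_varnE (f : {fps R}) m n :
  (f * fps_var ^+ m) n = if (m <= n)%N then f (n - m)%N else 0.
Proof.
elim: m n => [|m IH] n; first by rewrite expr0 mulr1 subn0.
by rewrite exprS mulrCA fps_var_mulE; case: n => [|n] //; rewrite IH ltnS subSS.
Qed.

Lemma mul_fps_seriesE (f : {fps R}) (G : nat -> {fps R}) k :
  (f * fps_series (fun m => G m * fps_var ^+ m)) k = \sum_(m < k.+1) (f * G m) (k - m)%N.
Proof.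
rewrite fpsME.
transitivity (\sum_(i < k.+1) \sum_(m < k.+1) f i * (G m * fps_var ^+ m) (k - i)%N).
  apply: eq_bigr => i _; rewrite -mulr_sumr; congr (_ * _).
  apply: (big_ord_widen0 (H := fun m => (G m * fps_var ^+ m) (k - i)%N)).
    by rewrite ltnS leq_subr.
  by move=> m; rewrite fps_mul_varnE ltnNge => /negbTE ->.
rewrite exchange_big; apply: eq_bigr => m _.
by rewrite -fpsME mulrA fps_mul_varnE -ltnS ltn_ord.
Qed.

Variable c : R.
(** The substitution of c t for t, a ring morphism by a coefficientwise check; it is used with c =
    e^z. *)
Definition fps_scale (f : {fps R}) : {fps R} := \fps_(n) (c ^+ n * f n).

Lemma fps_scale_is_zmod : zmod_morphism fps_scale.
Proof. by move=> f g; apply: fpsP => n; rewrite !(fpsDE, fpsNE) /= mulrBr. Qed.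
Lemma fps_scale_is_monoid : monoid_morphism fps_scale.
Proof.
split=> [|f g]; apply: fpsP => n.
  by case: n => [|n]; rewrite fps1E /= ?mulr0 // expr0 mulr1.
rewrite fpsME [LHS]mulr_sumr; apply: eq_bigr => i _ /=.
by rewrite mulrACA -exprD subnKC // -ltnS.
Qed.
HB.instance Definition _ := GRing.isZmodMorphism.Build {fps R} {fps R} fps_scale fps_scale_is_zmod.
HB.instance Definition _ := GRing.isMonoidMorphism.Build {fps R} {fps R} fps_scale fps_scale_is_monoid.

Lemma fps_scaleC a : fps_scale (fps_const a) = fps_const a.
Proof. by apply: fpsP => -[|n] /=; rewrite ?expr0 ?mul1r ?mulr0. Qed.

Lemma fps_comp_scale f : fps_comp f (fps_const c * fps_var) = fps_scale f.
Proof.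
apply: fpsP => n.
have g0 : (fps_const c * fps_var) 0 = 0 by rewrite fps_constME mulr0.
rewrite (fps_compE _ g0 (ltnSn n)) big_ord_recr /= big1 ?add0r.
  by rewrite exprMn -rmorphXn fps_constME fps_var_expE eqxx mulr1 mulrC.
move=> m _; rewrite exprMn -rmorphXn fps_constME fps_var_expE.
by rewrite gtn_eqF ?mulr0 ?ltn_ord.
Qed.

End Scaling.

Lemma outer_fps_comp (f g : Qz) : g 0%N = 0 ->
  fps_comp (outer_fps f) (outer_fps g) = outer_fps (fps_comp f g).
Proof.
move=> g0; apply: fpsP => n.
have og0 : outer_fps g 0 = 0 by rewrite /= g0 rmorph0.
rewrite (fps_compE _ og0 (ltnSn n)).
transitivity (fps_const (fps_comp f g n)); last by [].
rewrite (fps_compE _ g0 (ltnSn n)) rmorph_sum; apply: eq_bigr => m _.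
rewrite rmorphM; congr (_ * _).
by rewrite -[outer_fps g]/(fps_map (@fps_const rat) g) -rmorphXn.
Qed.

Lemma eval_ztau_scale c (F : {poly {poly rat}}) (u : Qzt) :
  fps_scale c (eval_ztau F u) = eval_ztau F (fps_scale c u).
Proof.
rewrite /eval_ztau !horner_coef rmorph_sum; apply: eq_bigr => i _.
rewrite rmorphM rmorphXn /= coef_map_id0 ?fps_scaleC //.
by rewrite !rmorph0.
Qed.

Lemma rmorph_div_exprz (R S : unitRingType) (f : {rmorphism R -> S}) a u (z : int) :
  u \is a GRing.unit -> f (a / u ^ z) = f a / f u ^ z.
Proof. by move=> uu; rewrite rmorphM rmorphV ?unitrXz // rmorphXz. Qed.

(** * The expansion in powers of the class of the affine line *)

Theorem theorem1p11
  (M : nat -> {poly int})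
  (HM : forall n, (3 <= n)%N -> is_Mbar_class_poly n (M n))
  (p : nat -> nat -> {poly rat})
  (Hp : forall k : nat,
     exp_fps 1 * \sum_(m < k.+1)
       (-1) ^+ m * poly_fps (p k m) * exp_fps (k - m)%N%:R
     = if k == 0%N then 1 + fps_var + alpha M 0 else alpha M k)
  (F : nat -> {poly {poly rat}})
  (HF : forall m : nat, (0 < m)%N ->
     let T := outer_fps tree_fps in
     \fps_(l) poly_fps (p (m + l)%N m)
     = fps_comp (outer_fps (exp_fps 1)) T
       * eval_ztau (F m) T / (1 - T) ^ (2 * m%:Z - 1)) :
  let T := fps_comp (outer_fps tree_fps) (fps_const (exp_fps 1) * fps_var) in
  let Fm m := if m == 0%N then (1 - T)^-1 else eval_ztau (F m) T in
  Mhat M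
  = fps_divX T
    * fps_series (fun m : nat =>
        (-1) ^+ m * Fm m / (1 - T) ^ (2 * m%:Z - 1) * fps_var ^+ m).
Proof.
move=> T Fm; pose e := exp_fps 1.
pose P m : Qzt := \fps_(l) poly_fps (p (m + l)%N m).
pose B := outer_fps (fps_divX tree_fps).
have TE : T = fps_scale e (outer_fps tree_fps) by rewrite /T fps_comp_scale.
(* The division by L takes one factor e^z out of T(e^z L). *)
have DE : fps_divX T = fps_const e * fps_scale e B.
  by apply: fpsP => n; rewrite TE fps_constME /= exprS mulrA.
have unitT0 : 1 - outer_fps tree_fps \is a GRing.unit.
  by rewrite fps_unitE fpsDE fpsNE fps1E fps_unitE fpsDE fpsNE fps1E /= subr0 unitr1.
have unitT : 1 - T \is a GRing.unit.
  by rewrite TE -(rmorph1 (fps_scale e)) -rmorphB rmorph_unit.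
(* The term of index m is (-1)^m e^z P_m(e^z L). *)
have main m : fps_divX T * ((-1) ^+ m * Fm m / (1 - T) ^ (2 * m%:Z - 1))
    = (-1) ^+ m * (fps_const e * fps_scale e (P m)).
  case: m => [|m].
    (* For m = 0 the exponent is -1, so [Fm 0] cancels and T/L alone remains; [leading_coef]
       identifies it. *)
    rewrite expr0 !mul1r /Fm eqxx mulr0 sub0r exprN1 divrr ?unitrV // mulr1 DE.
    congr (_ * fps_scale e _); apply: fpsP => l /=.
    by rewrite (leading_coef HM Hp) poly_fpsC.
  have -> : fps_scale e (P m.+1)
      = fps_scale e B * eval_ztau (F m.+1) T / (1 - T) ^ (2 * m.+1%:Z - 1).
    (* The definition of F_m, with e^T rewritten as T/t and e^z L substituted for t. *)
    rewrite /P HF //; move: (2 * m.+1%:Z - 1) => z.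
    apply: etrans (rmorph_div_exprz (fps_scale e) _ z unitT0) _.
    apply: (congr2 (fun x y : Qzt => x / y ^ z)); last by rewrite TE rmorphB rmorph1.
    apply: etrans (rmorphM (fps_scale e) _ _) _.
    apply: (congr2 *%R); last by rewrite TE; apply: eval_ztau_scale.
    by apply: (congr1 (fps_scale e)); rewrite outer_fps_comp // exp_tree.
  rewrite DE /Fm /=; move: (_ ^ _)^-1 => u.
  by rewrite [LHS]mulrA [fps_const e * _ * (_ * _)]mulrCA -!mulrA.
(* In degree k the term of index m contributes (-1)^m e^z times the coefficient of L^(k-m) in
   P_m(e^z L), which is p^(k)_m e^((k-m)z). *)
apply: fpsP => k; rewrite mul_fps_seriesE (Mhat_coef Hp) mulr_sumr; apply: eq_bigr => m _.
rewrite main -(rmorphN1 (@fps_const Qz)) -rmorphXn fps_constME fps_constME /=.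
rewrite subnKC -1?ltnS // exp_fps_nat -/e -mulrA mulrCA.
by rewrite (mulrC (poly_fps _)).
Qed.
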